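(* Let $p(\cdot)$ be an irreducible transition probability kernel on $\mathbb{Z}$ with $\sum_x |x|p(x)<\infty$, and suppose that $\sum_x |x|^c p(x)=\infty$ for some $c<2$. Let $(\eta_t)_{t\ge 0}$ be the one-dimensional voter model with kernel $p(\cdot)$ started from the Heaviside configuration $\eta_0$. Then the family $(r_t-l_t)_{t\ge 0}$ is not tight.
   Context: A transition probability kernel $p(\cdot)$ on $\mathbb{Z}$ is irreducible if $\{x: p(x)+p(-x)>0\}$ generates $\mathbb{Z}$. The voter model with kernel $p$ is the spin system on $\{0,1\}^{\mathbb{Z}}$ in which site $x$ flips at rate $c(x,\eta)=\sum_y p(y-x)\mathbf{1}_{\eta(x)\neq\eta(y)}$. The Heaviside configuration is $\eta_0(z)=1$ for $z\le 0$ and $\eta_0(z)=0$ for $z\ge 1$. For $t>0$, $r_t=\sup\{x:\eta_t(x)=1\}$ and $l_t=\inf\{x:\eta_t(x)=0\}$ (a.s. finite under the first moment assumption). *)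

(* Defs.v *)
From HB Require Import structures.
From mathcomp Require Import all_boot all_order all_algebra.
From mathcomp Require Import all_classical all_reals all_analysis.
Set Implicit Arguments. Unset Strict Implicit. Unset Printing Implicit Defensive.
Import Order.TTheory GRing.Theory Num.Theory.
Local Open Scope classical_set_scope.
Local Open Scope ring_scope.

Section VoterDefs.
Variable R : realType.

Definition transition_kernel_Z (p : int -> R) : Prop :=
  (forall x, 0 <= p x) /\ (\esum_(x in [set: int]) (p x)%:E = 1)%E.

Definition generates_Z (S : set int) : Prop :=
  forall G : set int, G 0 -> (forall a b, G a -> G b -> G (a + b)) ->
    (forall a, G a -> G (- a)) -> S `<=` G -> G = [set: int].

Definition irreducible_kernel (p : int -> R) : Prop :=
  generates_Z [set x | 0 < p x + p (- x)].

Definition finite_first_moment (p : int -> R) : Prop :=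
  (\esum_(x in [set: int]) ((`|x|%:~R : R) * p x)%:E < +oo)%E.

Definition infinite_moment (p : int -> R) (c : R) : Prop :=
  (\esum_(x in [set: int]) (((`|x|%:~R : R) `^ c) * p x)%:E = +oo)%E.

(** Harris graphical construction: each site z has i.i.d. Exp(1) inter-arrival
    times tau z 0, tau z 1, ...; at its k-th event site z adopts the opinion of
    site z + Y z k, where Y z k has law p.  Event times: *)
Definition evt (tau : int -> nat -> R) (z : int) (k : nat) : R :=
  \sum_(i < k.+1) tau z i.

(** The backward (dual) path started at (x,t) ends, at time 0, at site y. *)
Definition bwd_ends (tau : int -> nat -> R) (Y : int -> nat -> int)
    (x : int) (t : R) (y : int) : Prop :=
  exists (n : nat) (zs : nat -> int) (ks : nat -> nat) (ss : nat -> R),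
    [/\ zs 0%N = x, ss 0%N = t, zs n = y,
     (forall i, (i < n)%N ->
        [/\ 0 < evt tau (zs i) (ks i) < ss i,
            ss i.+1 = evt tau (zs i) (ks i),
            (forall j, 0 < evt tau (zs i) j < ss i -> (j <= ks i)%N) &
            zs i.+1 = zs i + Y (zs i) (ks i)])
     & (forall j, ~ (0 < evt tau (zs n) j < ss n))].

Definition heaviside (z : int) : bool := (z <= 0).

Definition voter_one (tau : int -> nat -> R) (Y : int -> nat -> int)
    (t : R) (x : int) : Prop :=
  exists y, bwd_ends tau Y x t y /\ heaviside y.

Definition r_t tau Y (t : R) : \bar R :=
  ereal_sup [set (x%:~R : R)%:E | x in [set x | voter_one tau Y t x]].
Definition l_t tau Y (t : R) : \bar R :=
  ereal_inf [set (x%:~R : R)%:E | x in [set x | ~ voter_one tau Y t x]].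

End VoterDefs.

Definition harris_independent (d : measure_display) (T : measurableType d)
    (R : realType) (P : probability T R)
    (tau : int -> nat -> T -> R) (Y : int -> nat -> T -> int) : Prop :=
  forall (J : seq (int * nat)), uniq J ->
  forall (A : int * nat -> set R) (B : int * nat -> set int),
    (forall j, measurable (A j)) ->
    P (\bigcap_(j in [set j | j \in J])
          (tau j.1 j.2 @^-1` A j `&` Y j.1 j.2 @^-1` B j)) =
    (\prod_(j <- J) (P (tau j.1 j.2 @^-1` A j) * P (Y j.1 j.2 @^-1` B j)))%E.

Definition harris_data (d : measure_display) (T : measurableType d)
    (R : realType) (P : probability T R) (p : int -> R)
    (tau : int -> nat -> T -> R) (Y : int -> nat -> T -> int) : Prop :=
  [/\ (forall z k, measurable_fun setT (tau z k)),
      (forall z k w, measurable (Y z k @^-1` [set w])),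
      (forall z k s, 0 <= s -> P [set om | s < tau z k om] = (expR (- s))%:E),
      (forall z k w, P (Y z k @^-1` [set w]) = (p w)%:E)
    & harris_independent P tau Y].

(* Main.v *)
Require Import Defs.
From HB Require Import structures.
From mathcomp Require Import all_boot all_order all_algebra.
From mathcomp Require Import all_classical all_reals all_analysis.
From mathcomp Require Import measurable_realfun ring lra zify.
Set Implicit Arguments. Unset Strict Implicit. Unset Printing Implicit Defensive.
Import Order.TTheory GRing.Theory Num.Theory.
Local Open Scope classical_set_scope.
Local Open Scope ring_scope.

(** Write [theta L] for the expectation of [min 1 (xi^2 / L^2)], where [xi] has
    law [p].  Since a moment of order [c < 2] is infinite, there are [kappa > 0]
    and arbitrarily large [L] with [P (|xi| >= 8 L) >= kappa * theta L]: otherwise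
    [L^2 * theta L] would grow so slowly that the [c]-th moment would be finite.
    At such a scale let [t = 1 / (8 * theta L)] and follow the dual walks of two
    sites [x > y] at distance about [3 L], placed so that the mean displacement
    (of the walk with jumps truncated at [L]) brings both a few [L] to the right
    of [0] if the left tail is the heavy one (to the left of [0] otherwise).  By
    Chebyshev each walk stays within [L] of its mean displacement up to time [t]
    with probability at least [1 - t * theta L], whereas one of the two walks
    jumps over [0] and over the other walk with probability of order
    [t * kappa * theta L = kappa / 8].  So, with probability bounded below
    uniformly in [L], the walk from [x] ends in [z <= 0] and the one from [y] in
    [z > 0]; then [x] carries a one, [y] a zero, and [r_t - l_t >= 2 L].

    The law of the dual pair is never computed: the Harris construction yields a
    one-step lower bound for the crossing probability over a time step [h], up to
    an error of order [h^2], and explicit test functions satisfying the reverse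
    inequality are compared with it along a fine time grid. *)

(** * Drifting walks and supersolutions *)

Section truncated_moments.
Context {R : realType}.
Variables (p : int -> R) (r : seq int).

Definition trunc_theta (L : R) : R :=
  \sum_(k <- r) p k * Num.min 1 (k%:~R ^+ 2 / L ^+ 2).

Definition trunc_mean (L : R) : R :=
  \sum_(k <- r | `|k%:~R| < L) p k * k%:~R.

Hypothesis p0 : forall k, 0 <= p k.
Hypothesis p1 : \sum_(k <- r) p k <= 1.

Lemma trunc_theta_ge0 L : 0 <= trunc_theta L.
Proof.
apply: sumr_ge0 => k _; rewrite mulr_ge0 // le_min ler01 /=.
by rewrite divr_ge0 // sqr_ge0.
Qed.

Lemma trunc_mean_le L : 0 < L -> `|trunc_mean L| <= L.
Proof.
move=> L0; apply: le_trans (ler_norm_sum _ _ _) _.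
rewrite big_mkcond /=; apply: (@le_trans _ _ (\sum_(k <- r) p k * L)).
  apply: ler_sum => k _; case: ifPn => [kL|_].
    by rewrite normrM (ger0_norm (p0 k)) ler_wpM2l // ltW.
  by rewrite mulr_ge0 // ltW.
by rewrite -mulr_suml -[leRHS]mul1r ler_wpM2r // ltW.
Qed.

Section supersolution.
Variables (L : R) (w w1 : R -> R).
Hypothesis L0 : 0 < L.
Hypothesis w0 : forall v, 0 <= w v.
Hypothesis w_lo : forall v y, w v + w1 v * y <= w (v + y).
Hypothesis w_up : forall v y, w (v + y) <= w v + w1 v * y + y ^+ 2.

(** Bounds the probability that the walk started at [x], observed in the frame
    moving with [trunc_mean L], leaves [w < L ^+ 2] within time [s]. *)
Definition dev (s : R) (x : int) : R :=
  Num.min 1 (w (x%:~R + trunc_mean L * s) / L ^+ 2 + s * trunc_theta L).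

Lemma dev_le1 s x : dev s x <= 1.
Proof. by rewrite /dev ge_min lexx. Qed.

Lemma dev_ge0 s x : 0 <= s -> 0 <= dev s x.
Proof.
move=> s0; rewrite /dev le_min ler01 /=.
by rewrite addr_ge0 ?mulr_ge0 ?trunc_theta_ge0 ?invr_ge0 ?sqr_ge0.
Qed.

(** Jumps shorter than [L] are expanded to second order: their linear part is the drift, absorbed by
    the moving frame thanks to [w_lo], and their squares form part of [trunc_theta L]. A longer jump
    costs at most 1, which is exactly its share of [trunc_theta L]. *)
Lemma dev_step s h x : 0 <= s -> 0 <= h <= 1 ->
  (1 - h) * dev s x + h * \sum_(k <- r) p k * dev s (x + k) <= dev (s + h) x.
Proof.
move=> s0 /andP[h0 h1]; set L2 := L ^+ 2.
have L20 : 0 < L2 by rewrite exprn_gt0.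
have L2i : 0 <= L2^-1 by rewrite invr_ge0 ltW.
rewrite {3}/dev le_min; apply/andP; split.
  have : \sum_(k <- r) p k * dev s (x + k) <= 1.
    apply: le_trans p1; apply: ler_sum => k _.
    by rewrite -[leRHS]mulr1 ler_wpM2l // dev_le1.
  have := dev_le1 s x.
  set a := dev s x; set b := \sum_(_ <- _) _ => ha hb.
  rewrite -(subrK h 1) lerD //; last by rewrite -[leRHS]mulr1 ler_wpM2l.
  by rewrite subrK -[leRHS]mulr1 ler_wpM2l // subr_ge0.
set v0 := x%:~R + trunc_mean L * s.
pose a0 := w v0 / L2 + s * trunc_theta L.
have a00 : 0 <= a0 by rewrite addr_ge0 // ?mulr_ge0 ?trunc_theta_ge0.
have ak k : p k * dev s (x + k) <= p k * a0 +
    (if `|k%:~R| < L then p k * k%:~R else 0) * (w1 v0 / L2)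
    + p k * Num.min 1 (k%:~R ^+ 2 / L2).
  case: ifPn => kL.
    have -> : Num.min 1 (k%:~R ^+ 2 / L2) = k%:~R ^+ 2 / L2.
      apply/min_idPr; rewrite ler_pdivrMr // mul1r -real_normK ?num_real //.
      by rewrite ler_pXn2r ?nnegrE ?normr_ge0 // ?ltW.
    rewrite -(mulrA _ k%:~R) -!mulrDr ler_wpM2l //.
    rewrite /dev ge_min; apply/orP; right.
    have -> : (x + k)%:~R + trunc_mean L * s = v0 + k%:~R.
      by rewrite intrD /v0; ring.
    have := w_up v0 k%:~R; move/(ler_wpM2r L2i) => H.
    rewrite -/L2 /a0; lra.
  rewrite mul0r addr0 -mulrDr ler_wpM2l //.
  rewrite (le_trans (dev_le1 _ _)) //.
  have -> : Num.min 1 (k%:~R ^+ 2 / L2) = 1.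
    apply/min_idPl; rewrite ler_pdivlMr // mul1r -[in leRHS]real_normK ?num_real //.
    by rewrite ler_pXn2r ?nnegrE ?normr_ge0 ?(ltW L0) // leNgt.
  by rewrite lerDr.
have sumle : \sum_(k <- r) p k * dev s (x + k) <=
    a0 + trunc_mean L * (w1 v0 / L2) + trunc_theta L.
  apply: le_trans (ler_sum _ (fun k _ => ak k)) _.
  rewrite !big_split /= -!mulr_suml -big_mkcond /= lerD // lerD //.
  by rewrite -[leRHS]mul1r ler_wpM2r.
have dle : dev s x <= a0 by rewrite /dev ge_min lexx orbT.
have lo := w_lo v0 (trunc_mean L * h).
have lo2 : w v0 / L2 + w1 v0 * (trunc_mean L * h) / L2 <=
   w (x%:~R + trunc_mean L * (s + h)) / L2.
  rewrite -mulrDl ler_wpM2r //.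
  by have -> : x%:~R + trunc_mean L * (s + h) = v0 + trunc_mean L * h by rewrite /v0; ring.
have h10 : 0 <= 1 - h by rewrite subr_ge0.
apply: le_trans (lerD (ler_wpM2l h10 dle) (ler_wpM2l h0 sumle)) _.
have -> : (1 - h) * a0 + h * (a0 + trunc_mean L * (w1 v0 / L2) + trunc_theta L)
   = w v0 / L2 + w1 v0 * (trunc_mean L * h) / L2 + (s + h) * trunc_theta L.
  by rewrite /a0; ring.
by rewrite lerD2r.
Qed.

End supersolution.
End truncated_moments.

(** * Lower bound for the crossing probability of two walks *)

Section pair_lower_bound.
Context {R : realType}.
(** [b s x y] stands for the probability that the walks from [x] and [y], run for time [s], end on
    the left and on the right of 0. It is kept abstract so that the reflected probability can be
    substituted; [eps] bounds the mass of the jumps outside [r]. *)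
Variables (p : int -> R) (r : seq int) (b : R -> int -> int -> R).
Variables (eps L : R).
Hypothesis p0 : forall k, 0 <= p k.
Hypothesis p1 : \sum_(k <- r) p k <= 1.
Hypothesis peps : 1 - \sum_(k <- r) p k <= eps.
Hypothesis b0 : forall s x y, 0 <= b s x y.
Hypothesis b_init : forall x y, x < 0 < y -> 1 <= b 0 x y.
Hypothesis b_step : forall s h x y, x != y -> 0 <= s -> 0 < h ->
  (1 - 2 * h) * b s x y
  + h * \sum_(k <- r) p k * (b s (x + k) y + b s x (y + k)) - 8 * h ^+ 2
  <= b (s + h) x y.
Hypothesis L1 : 1 <= L.

Let L0 : 0 < L. Proof. exact: lt_le_trans ltr01 L1. Qed.
Let eps0 : 0 <= eps.
Proof. by apply: le_trans peps; rewrite subr_ge0. Qed.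

Local Notation theta := (trunc_theta p r L).
Local Notation mu := (trunc_mean p r L).
Local Notation far_left := (\sum_(k <- r | k%:~R <= - (8 * L)) p k).

(** The two instances of [w] in [dev]. [sq_at c] penalises deviations on both sides; [sq_above c]
    penalises only positions above [c], for a walk that may be anywhere far to the left after its
    jump. *)
Definition sq_at (c v : R) : R := (v - c) ^+ 2.
Definition sq_above (c v : R) : R := Num.max 0 (v - c) ^+ 2.

Lemma sq_at_lo c v y : sq_at c v + 2 * (v - c) * y <= sq_at c (v + y).
Proof. by rewrite /sq_at; have := sqr_ge0 y; rewrite !expr2; nra. Qed.

Lemma sq_at_up c v y :
  sq_at c (v + y) <= sq_at c v + 2 * (v - c) * y + y ^+ 2.
Proof. by rewrite /sq_at !expr2; nra. Qed.

Lemma sq_above_lo c v y :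
  sq_above c v + 2 * Num.max 0 (v - c) * y <= sq_above c (v + y).
Proof.
rewrite /sq_above !expr2.
by case: (leP 0 (v - c)); case: (leP 0 (v + y - c)) => ? ?; nra.
Qed.

Lemma sq_above_up c v y :
  sq_above c (v + y) <= sq_above c v + 2 * Num.max 0 (v - c) * y + y ^+ 2.
Proof.
rewrite /sq_above !expr2.
by case: (leP 0 (v - c)); case: (leP 0 (v + y - c)) => ? ?; nra.
Qed.

Lemma sq_at_ge0 c v : 0 <= sq_at c v. Proof. exact: sqr_ge0. Qed.
Lemma sq_above_ge0 c v : 0 <= sq_above c v. Proof. exact: sqr_ge0. Qed.

(** Since only one walk moves at a time, the one-step inequalities of the two sites simply add up.
    Missing mass [1 - S] helps in the terms with [u] and [v], and costs at most [2 * h * eps] in the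
    constant [C <= 1]. *)
Lemma pair_step (C bt h : R) (u v u' v' : int -> R) (x y : int) :
  0 <= C <= 1 -> 0 <= bt -> 0 <= h ->
  (forall k, 0 <= u k) -> (forall k, 0 <= v k) ->
  (1 - h) * u x + h * \sum_(k <- r) p k * u (x + k) <= u' x ->
  (1 - h) * v y + h * \sum_(k <- r) p k * v (y + k) <= v' y ->
  C - bt * (u' x + v' y) - 2 * h * eps <=
  (1 - 2 * h) * (C - bt * (u x + v y)) + h * \sum_(k <- r) p k *
    ((C - bt * (u (x + k) + v y)) + (C - bt * (u x + v (y + k)))).
Proof.
move=> /andP[C0 C1] bt0 h0 u0 v0 uu vv.
have S1 := p1; have Se := peps; set S := \sum_(k <- r) p k in S1 Se *.
have -> : \sum_(k <- r) p k *
    ((C - bt * (u (x + k) + v y)) + (C - bt * (u x + v (y + k)))) =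
    S * (2 * C - bt * (u x + v y)) - bt * (\sum_(k <- r) p k * u (x + k)) -
    bt * (\sum_(k <- r) p k * v (y + k)).
  rewrite /S mulr_suml !mulr_sumr -!sumrB; apply: eq_bigr => k _; ring.
set U := \sum_(k <- r) _ in uu *; set V := \sum_(k <- r) _ in vv *.
have := ler_wpM2l bt0 uu; have := ler_wpM2l bt0 vv.
have hS : 0 <= h * (1 - S) by rewrite mulr_ge0 // subr_ge0.
have hSe : h * (1 - S) * C <= h * eps.
  rewrite -mulrA ler_wpM2l // (le_trans _ Se) // -[leRHS]mulr1 ler_wpM2l //.
  by rewrite subr_ge0.
have : 0 <= h * (1 - S) * (bt * (u x + v y)) by rewrite mulr_ge0 // mulr_ge0 // addr_ge0.
nra.
Qed.

Section test_functions.
(** [c'], and later [c], are the mean final positions of the second and the first walk, prescribed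
    up to 1 because sites are integers. Within [L] of them the second walk is positive and, as
    [1 <= L], below the first. *)
Variables (c' t h : R).
Hypothesis c'L : L <= c'.
Hypothesis c'L1 : c' < L + 1.
Hypothesis h01 : 0 < h <= 1 / 20%:R.

Local Notation before := (dev p r L (sq_at c')).
Local Notation after := (dev p r L (sq_above (- L))).
(** Error per unit of time: a step of length [h] loses [2 * h * eps] in [pair_step] and [8 * h ^+ 2]
    in [b_step]. *)
Let e : R := 2 * eps + 8 * h.

Let h0 : 0 < h. Proof. by case/andP: h01. Qed.
Let hle : h <= 1 / 20%:R. Proof. by case/andP: h01. Qed.
Let h01' : 0 <= h <= 1. Proof. by apply/andP; split; have := h0; have := hle; lra. Qed.
Let e0 : 0 <= e. Proof. by rewrite /e; have := eps0; have := h0; lra. Qed.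

Let after_ge0 x s : 0 <= s -> 0 <= after s x.
Proof. by move=> s0; apply: dev_ge0 => // v; exact: sq_above_ge0. Qed.
Let at_ge0 c x s : 0 <= s -> 0 <= dev p r L (sq_at c) s x.
Proof. by move=> s0; apply: dev_ge0 => // v; exact: sq_at_ge0. Qed.

Lemma dev_lt1 w s x : 0 <= s -> dev p r L w s x < 1 ->
  w (x%:~R + mu * s) < L ^+ 2.
Proof.
move=> s0; rewrite /dev gt_min ltxx /= => H.
have : w (x%:~R + mu * s) / L ^+ 2 < 1.
  apply: le_lt_trans H; rewrite lerDl mulr_ge0 //; exact: trunc_theta_ge0.
by rewrite ltr_pdivrMr ?exprn_gt0 // mul1r.
Qed.

Lemma sq_at_lt c v : sq_at c v < L ^+ 2 -> c - L < v < c + L.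
Proof.
rewrite /sq_at => H.
have : `|v - c| < L.
  rewrite -(@ltr_pXn2r _ 2) ?nnegrE ?normr_ge0 ?(ltW L0) //.
  by rewrite real_normK ?num_real.
by rewrite ltr_norml => /andP[? ?]; apply/andP; split; lra.
Qed.

Lemma sq_above_lt c v : sq_above c v < L ^+ 2 -> v < c + L.
Proof.
rewrite /sq_above ltr_pXn2r ?nnegrE ?le_max ?lexx ?(ltW L0) //.
by rewrite gt_max => /andP[_ ?]; lra.
Qed.

(** The first walk has already jumped to the left of [- L]. *)
Lemma after_jump_lower (i : nat) x y :
  1 - (after (i%:R * h) x + before (i%:R * h) y) - e * (i%:R * h)
  <= b (i%:R * h) x y.
Proof.
elim: i x y => [|i IH] x y.
  rewrite !mul0r mulr0 subr0.
  have [H|H] := lerP (1 - (after 0 x + before 0 y)) 0; first exact: le_trans (b0 _ _ _).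
  have a0 := after_ge0 x (lexx 0).
  have bb0 := at_ge0 c' y (lexx 0).
  have /(dev_lt1 (lexx 0))/sq_above_lt : after 0 x < 1 by lra.
  rewrite mulr0 addr0 addNr => x0.
  have /(dev_lt1 (lexx 0))/sq_at_lt : before 0 y < 1 by lra.
  rewrite mulr0 addr0 => /andP[y0 _].
  apply: le_trans (b_init _ ); first by lra.
  by apply/andP; split; [rewrite -(ltrz0 R)|rewrite -(ltr0z R); have := c'L; lra].
set s := i%:R * h.
have s0 : 0 <= s by rewrite mulr_ge0 // ltW.
have -> : i.+1%:R * h = s + h by rewrite /s -natr1 mulrDl mul1r.
have sh0 : 0 <= s + h by rewrite addr_ge0 // ltW.
have a0 := after_ge0 x sh0.
have bb0 := at_ge0 c' y sh0.
have es0 : 0 <= e * (s + h) by rewrite mulr_ge0.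
(* Unless the bound is trivial, both deviations are below 1; this puts the walks on opposite sides
   of 0 in the moving frame, so that [x != y], as [b_step] requires. *)
have [H|H] := lerP (1 - (after (s + h) x + before (s + h) y)) 0.
  by apply: le_trans (b0 _ _ _); lra.
have /(dev_lt1 sh0)/sq_above_lt x0 : after (s + h) x < 1 by lra.
have /(dev_lt1 sh0)/sq_at_lt/andP[y0 _] : before (s + h) y < 1 by lra.
have xy : x != y by apply/eqP => xy; move: x0 y0; rewrite xy; have := c'L; lra.
apply: le_trans (b_step xy s0 h0).
have := @pair_step 1 1 h (after s) (before s) (after (s + h)) (before (s + h)) x y.
rewrite ler01 lexx !mul1r => /(_ isT isT (ltW h0)).
move=> /(_ (fun k => after_ge0 k s0)).
move=> /(_ (fun k => at_ge0 _ k s0)).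
move=> /(_ (dev_step p0 p1 L0 (sq_above_ge0 _) (@sq_above_lo _) (@sq_above_up _) x s0 h01')).
move=> /(_ (dev_step p0 p1 L0 (sq_at_ge0 _) (@sq_at_lo _) (@sq_at_up _) y s0 h01')).
set T1 := \sum_(k <- r) _ => ps.
set T2 := \sum_(k <- r) _.
have T12 : T1 - 2 * (e * s) <= T2.
  have : \sum_(k <- r) p k * (2 * (e * s)) <= 2 * (e * s).
    by rewrite -mulr_suml -[leRHS]mul1r ler_wpM2r // mulr_ge0 // mulr_ge0.
  suff : T1 - \sum_(k <- r) p k * (2 * (e * s)) <= T2 by lra.
  rewrite /T1 /T2 -sumrB; apply: ler_sum => k _.
  rewrite -mulrBr ler_wpM2l //.
  have := IH (x + k) y; have := IH x (y + k); rewrite -/s !mul1r; lra.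
have := ler_wpM2l (ltW h0) T12.
have : (1 - 2 * h) * (1 - (after s x + before s y) - e * s) <= (1 - 2 * h) * b s x y.
  by rewrite ler_wpM2l //; have := hle; lra.
have -> : e * (s + h) = e * s + 2 * (h * eps) + 8 * (h ^+ 2) by rewrite /e; ring.
lra.
Qed.

Variable c : R.
Hypothesis cL : 4 * L <= c.
Hypothesis cL1 : c < 4 * L + 1.
Hypothesis theta0 : 0 < theta.
Hypothesis tE : t = (8 * theta)^-1.
Local Notation start := (dev p r L (sq_at c)).
(** The factor 4: after a far jump [after_jump_lower] yields, up to the error, at least
    [1 - 1 / 8 - 5 / 8 = 1 / 4], where [1 / 8] bounds [after] and [1 / 2 + 1 / 8] bounds
    [before]. *)
Let gam : R := far_left / 4.

Let far_le : far_left <= theta.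
Proof.
rewrite big_mkcond /=; apply: ler_sum => k _; case: ifPn => kL; last first.
  by rewrite mulr_ge0 // le_min ler01 /= divr_ge0 // sqr_ge0.
rewrite -[leLHS]mulr1 ler_wpM2l // le_min lexx /= ler_pdivlMr ?exprn_gt0 // mul1r.
rewrite -[leRHS]sqrrN ler_pXn2r ?nnegrE ?(ltW L0) //; have := L0; lra.
Qed.

Let gam0 : 0 <= gam. Proof. by rewrite divr_ge0 // sumr_ge0. Qed.
Let t0 : 0 < t. Proof. by rewrite tE invr_gt0 mulr_gt0. Qed.
Let gamt : gam * t <= 1 / 32%:R.
Proof.
rewrite tE /gam; rewrite ler_pdivrMr ?mulr_gt0 //; have := far_le; lra.
Qed.

(** The term [gam * s] is paid for by the jumps of length at most [- 8 * L] of the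
    first walk, which lead to configurations covered by [after_jump_lower]. *)
Lemma before_jump_lower (i : nat) x y : i%:R * h <= t ->
  gam * (i%:R * h) - 2 * gam * t * (start (i%:R * h) x + before (i%:R * h) y)
   - e * (i%:R * h) <= b (i%:R * h) x y.
Proof.
have bt0 : 0 <= 2 * gam * t by rewrite mulr_ge0 ?(ltW t0) // mulr_ge0.
elim: i x y => [|i IH] x y.
  rewrite !mul0r !mulr0 subr0 sub0r => _; apply: le_trans (b0 _ _ _).
  by rewrite oppr_le0 mulr_ge0 // addr_ge0 // at_ge0.
set s := i%:R * h.
have s0 : 0 <= s by rewrite mulr_ge0 // ltW.
have -> : i.+1%:R * h = s + h by rewrite /s -natr1 mulrDl mul1r.
move=> sht.
have st : s <= t by have := h0; lra.
have sh0 : 0 <= s + h by rewrite addr_ge0 // ltW.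
have a0 := at_ge0 c x sh0.
have bb0 := at_ge0 c' y sh0.
have es0 : 0 <= e * (s + h) by rewrite mulr_ge0.
have gst : gam * (s + h) <= gam * t by rewrite ler_wpM2l.
(* If the deviations sum to at least [1 / 2], the subtracted term is at least [gam * t] and the
   claim is trivial; this is the purpose of the factor 2 in the statement. *)
have [H|H] := lerP (1 / 2) (start (s + h) x + before (s + h) y).
  apply: le_trans (b0 _ _ _).
  have := ler_wpM2l bt0 H; lra.
have /(dev_lt1 sh0)/sq_at_lt/andP[x0 x1] : start (s + h) x < 1 by lra.
have /(dev_lt1 sh0)/sq_at_lt/andP[y0 y1] : before (s + h) y < 1 by lra.
have xy : x != y by apply/eqP => xy; move: x0 y1; rewrite xy; have := L1; have := cL; have := c'L1; lra.
apply: le_trans (b_step xy s0 h0).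
have gs1 : 0 <= gam * s <= 1.
  apply/andP; split; first by rewrite mulr_ge0.
  have : gam * s <= gam * t by rewrite ler_wpM2l.
  by have := gamt; lra.
have := @pair_step (gam * s) (2 * gam * t) h
  (start s) (before s) (start (s + h)) (before (s + h)) x y gs1 bt0 (ltW h0).
move=> /(_ (fun k => at_ge0 _ k s0)).
move=> /(_ (fun k => at_ge0 _ k s0)).
move=> /(_ (dev_step p0 p1 L0 (sq_at_ge0 _) (@sq_at_lo _) (@sq_at_up _) x s0 h01')).
move=> /(_ (dev_step p0 p1 L0 (sq_at_ge0 _) (@sq_at_lo _) (@sq_at_up _) y s0 h01')).
set T1 := \sum_(k <- r) _ => ps.
set T2 := \sum_(k <- r) _.
have muL := trunc_mean_le p0 p1 L0.
have muh : `|mu * h| <= L * (1 / 20%:R).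
  by rewrite normrM (gtr0_norm h0) ler_pM // ltW.
move: muh; rewrite ler_norml => /andP[muh1 muh2].
(* In one step the frame moves by at most [L / 20], and within [L] of [c'] this changes the square
   by at most [L ^+ 2 / 10 + L ^+ 2 / 400]. *)
have bL : before s y <= before (s + h) y + 1 / 8.
  rewrite {1}/dev.
  have -> : before (s + h) y = sq_at c' (y%:~R + mu * (s + h)) / L ^+ 2 + (s + h) * theta.
    move: H; rewrite /dev; case: (leP 1 (sq_at c' (y%:~R + mu * (s + h)) / L ^+ 2 + (s + h) * theta)) => // ? ?.
    by exfalso; move: a0; rewrite /dev; lra.
  rewrite ge_min; apply/orP; right.
  have : s * theta <= (s + h) * theta by rewrite ler_wpM2r ?lerDl // ltW.
  have : sq_at c' (y%:~R + mu * s) / L ^+ 2 <= sq_at c' (y%:~R + mu * (s + h)) / L ^+ 2 + 1 / 8.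
    have -> : y%:~R + mu * s = y%:~R + mu * (s + h) - mu * h by ring.
    move: y0 y1; set v := y%:~R + _; set m := mu * h in muh1 muh2 *; rewrite /sq_at => y0 y1.
    rewrite ler_pdivrMr ?exprn_gt0 // mulrDl divfK ?expf_neq0 ?gt_eqF //.
    have [z0 z1] : - L <= v - c' /\ v - c' <= L by split; lra.
    rewrite (_ : v - m - c' = (v - c') - m); last by ring.
    set z := v - c' in z0 z1 *; rewrite !expr2; have := L0; nra.
  lra.
have T12 : T1 + far_left / 4 - 2 * (e * s) <= T2.
  have : \sum_(k <- r) p k * (2 * (e * s)) <= 2 * (e * s).
    by rewrite -mulr_suml -[leRHS]mul1r ler_wpM2r // mulr_ge0 // mulr_ge0.
  suff : T1 + far_left / 4 - \sum_(k <- r) p k * (2 * (e * s)) <= T2 by lra.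
  rewrite /T1 /T2 (big_mkcond (fun k : int => k%:~R <= - (8 * L))) /=.
  rewrite mulr_suml -big_split -sumrB /=.
  apply: ler_sum => k _.
  have e1 := IH (x + k) y st; have e2 := IH x (y + k) st.
  rewrite -/s in e1 e2.
  case: ifPn => kL; last by rewrite mul0r addr0 -mulrBr ler_wpM2l //; lra.
  rewrite -mulrDr -mulrBr ler_wpM2l //.
  have e3 := after_jump_lower i (x + k) y; rewrite -/s in e3.
  (* The first walk was below [5 * L + 1] and the frame moved by at most [L / 20], so a jump of at
     most [- 8 * L] leads below [- L]. *)
  have v0 : (x + k)%:~R + mu * s <= - L.
    have -> : (x + k)%:~R + mu * s = x%:~R + mu * (s + h) - mu * h + k%:~R.
      by rewrite intrD; ring.
    have := L1; have := cL1; lra.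
  have st8 : s * theta <= 1 / 8.
    have : s * theta <= t * theta by rewrite ler_wpM2r // ltW.
    have -> : t * theta = 1 / 8; last by [].
    by rewrite tE invfM -mulrA mulVf ?gt_eqF // mulr1 div1r.
  have aft : after s (x + k) <= 1 / 8.
    rewrite /dev ge_min; apply/orP; right.
    have -> : sq_above (- L) ((x + k)%:~R + mu * s) = 0.
      rewrite /sq_above (_ : Num.max _ _ = 0) ?expr0n //.
      by apply/max_idPl; lra.
    by rewrite mul0r add0r.
  (* The test function of the first walk saturates after the jump, so the summand it had in [T1] is
     nonpositive and the whole gain of [1 / 4] counts. *)
  have stt : start s (x + k) = 1.
    rewrite /dev; apply/min_idPl.
    rewrite -[leLHS]addr0 lerD //; last by rewrite mulr_ge0 ?(ltW theta0).
    rewrite ler_pdivlMr ?exprn_gt0 // mul1r /sq_at -[leRHS]sqrrN.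
    by rewrite ler_pXn2r ?nnegrE ?(ltW L0) //; have := L1; have := cL1; lra.
  rewrite stt.
  have : 0 <= gam * t by rewrite mulr_ge0 // ltW.
  have : 0 <= 2 * gam * t * before s y.
    by rewrite mulr_ge0 // at_ge0.
  have : gam * s <= gam * t by rewrite ler_wpM2l.
  lra.
have := ler_wpM2l (ltW h0) T12.
have : (1 - 2 * h) * (gam * s - 2 * gam * t * (start s x + before s y) - e * s)
   <= (1 - 2 * h) * b s x y.
  by rewrite ler_wpM2l //; [have := hle; lra | exact: IH].
have -> : e * (s + h) = e * s + 2 * (h * eps) + 8 * (h ^+ 2) by rewrite /e; ring.
have -> : far_left / 4 = gam by [].
lra.
Qed.

End test_functions.

(** Centering the squares at the actual mean final positions leaves deviations [t * theta = 1 / 8]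
    each. Hence [before_jump_lower] after [n.+1] steps gives [gam * t - 2 * gam * t / 4 = far_left *
    t / 8], up to the error. *)
Lemma pair_lower_bound n (t := (8 * theta)^-1) : 0 < theta ->
  t / n.+1%:R <= 1 / 20%:R ->
  exists x y : int, 2 * L <= (x - y)%:~R /\
    far_left / (64%:R * theta) - t * (2 * eps + 8 * (t / n.+1%:R)) <= b t x y.
Proof.
move=> theta0 tn.
have t0 : 0 < t by rewrite invr_gt0 mulr_gt0.
pose h := t / n.+1%:R.
have h0 : 0 < h by rewrite divr_gt0.
pose y : int := Num.ceil (L - mu * t).
pose x : int := Num.ceil (4 * L - mu * t).
have /andP[y1 y2] := ceil_itv (L - mu * t).
have /andP[x1 x2] := ceil_itv (4 * L - mu * t).
rewrite -/y -/x in x1 x2 y1 y2.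
have c1 : L <= y%:~R + mu * t by lra.
have c2 : y%:~R + mu * t < L + 1 by move: y1; rewrite intrB; lra.
have c3 : 4 * L <= x%:~R + mu * t by lra.
have c4 : x%:~R + mu * t < 4 * L + 1 by move: x1; rewrite intrB; lra.
have h01 : 0 < h <= 1 / 20%:R by rewrite h0.
have nh : n.+1%:R * h = t by rewrite /h mulrC divfK // pnatr_eq0.
exists x, y; split; first by rewrite intrB; have := L1; lra.
have := before_jump_lower c1 c2 h01 c3 c4 theta0 (erefl : t = (8 * theta)^-1) (i := n.+1) x y.
rewrite nh => /(_ (lexx _)); apply: le_trans.
have dE z : dev p r L (sq_at (z%:~R + mu * t)) t z <= 1 / 8.
  rewrite /dev ge_min; apply/orP; right.
  rewrite /sq_at subrr expr0n mul0r add0r /t invfM -mulrA mulVf ?gt_eqF //.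
  by rewrite mulr1 div1r.
have g0 : 0 <= far_left by rewrite sumr_ge0.
have := ler_wpM2l (_ : 0 <= 2 * (far_left / 4) * t) (lerD (dE x) (dE y)).
rewrite !mulr_ge0 ?(ltW t0) // => /(_ isT).
have -> : far_left / (64%:R * theta) = far_left * t / 8.
  by rewrite /t !invfM; field; rewrite gt_eqF.
rewrite -/h; lra.
Qed.

End pair_lower_bound.

(** * Scales with a heavy tail *)

Section integer_ranges.

Definition zrange (N : nat) : seq int := [seq i%:Z - N%:Z | i <- iota 0 N.*2.+1].

Lemma mem_zrange N k : (k \in zrange N) = (`|k| <= N%:Z).
Proof.
apply/mapP/idP => [[i]|kN]; first by rewrite mem_iota => ? ->; lia.
by exists (absz (k + N%:Z)); rewrite ?mem_iota; lia.
Qed.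

Lemma zrange_uniq N : uniq (zrange N).
Proof. by rewrite map_inj_uniq ?iota_uniq // => i j; lia. Qed.

Lemma sum_zrangeN (V : nmodType) N (F : int -> V) (Q : pred int) :
  \sum_(k <- zrange N | Q (- k)) F (- k) = \sum_(k <- zrange N | Q k) F k.
Proof.
rewrite -(big_map (fun k => - k) Q F); apply: perm_big; apply: uniq_perm.
- by rewrite map_inj_uniq ?zrange_uniq //; exact: oppr_inj.
- exact: zrange_uniq.
move=> k; rewrite mem_zrange -[k in LHS]opprK (mem_map oppr_inj) mem_zrange.
by rewrite normrN.
Qed.

Lemma ler_sum_uniq (R : numDomainType) (T : eqType) (s1 s2 : seq T) (F : T -> R) :
  uniq s1 -> uniq s2 -> {subset s1 <= s2} -> (forall k, 0 <= F k) ->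
  \sum_(k <- s1) F k <= \sum_(k <- s2) F k.
Proof.
move=> u1 u2 s12 F0.
have -> : \sum_(k <- s1) F k = \sum_(k <- s2 | k \in s1) F k.
  rewrite -[RHS]big_filter; apply: perm_big; apply: uniq_perm => //.
    exact: filter_uniq.
  by move=> k; rewrite mem_filter; case: (boolP (k \in s1)) => // /s12 ->.
by rewrite big_mkcond /=; apply: ler_sum => k _; case: ifP.
Qed.

Lemma ler_sum_zrange (R : numDomainType) (N N' : nat) (F : int -> R) :
  (N <= N')%N -> (forall k, 0 <= F k) ->
  \sum_(k <- zrange N) F k <= \sum_(k <- zrange N') F k.
Proof.
move=> NN' F0; apply: ler_sum_uniq => //; try exact: zrange_uniq.
by move=> k; rewrite !mem_zrange; lia.
Qed.

Lemma zrange_sub (s : seq int) : exists N0 : nat,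
  forall N, (N0 <= N)%N -> {subset s <= zrange N}.
Proof.
elim: s => [|k s [N0 IH]]; first by exists 0%N.
exists (maxn N0 (absz k)) => N; rewrite geq_max => /andP[/IH sN kN] z.
by rewrite inE => /orP[/eqP ->|/sN //]; rewrite mem_zrange; lia.
Qed.

Lemma esum_gt_zrange (R : realType) (f : int -> R) (B : R) :
  (forall k, 0 <= f k) -> (B%:E < \esum_(k in [set: int]) (f k)%:E)%E ->
  exists N0 : nat, forall N, (N0 <= N)%N -> B < \sum_(k <- zrange N) f k.
Proof.
move=> f0 /ereal_sup_gt[_ [A [finA _] <-]].
rewrite fsbig_finite //= sumEFin lte_fin => BA.
have [N0 N0P] := zrange_sub (finmap.enum_fset (fset_set A)).
exists N0 => N /N0P sN; apply: lt_le_trans BA _.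
by apply: ler_sum_uniq => //; [exact: finmap.fset_uniq | exact: zrange_uniq].
Qed.

Lemma esum_ge_zrange (R : realType) (f : int -> R) (N : nat) :
  ((\sum_(k <- zrange N) f k)%:E <= \esum_(k in [set: int]) (f k)%:E)%E.
Proof.
apply: ereal_sup_ubound; exists [set` zrange N].
  by split => //; exact: finite_seq.
by rewrite -fsbig_seq ?zrange_uniq // sumEFin.
Qed.

End integer_ranges.

Section heavy_scales.
Context {R : realType}.
Variables (p : int -> R) (c : R).
Hypothesis p0 : forall k, 0 <= p k.
Hypothesis p1 : forall N, \sum_(k <- zrange N) p k <= 1.
Hypothesis c2 : c < 2.
Hypothesis pc : forall B : R, exists N,
  B < \sum_(k <- zrange N) (`|k|%:~R : R) `^ c * p k.

Local Notation trunc_sq := (fun N (K : R) =>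
  \sum_(k <- zrange N) p k * Num.min (k%:~R ^+ 2) (K ^+ 2)).

Lemma trunc_sqE N K : 0 < K -> trunc_sq N K = K ^+ 2 * trunc_theta p (zrange N) K.
Proof.
move=> K0; rewrite /trunc_theta mulr_sumr; apply: eq_bigr => k _.
have K20 : 0 < K ^+ 2 by rewrite exprn_gt0.
rewrite mulrCA; congr (_ * _); rewrite minr_pMr ?(ltW K20) // mulr1 minC.
by rewrite mulrCA mulfV ?gt_eqF // mulr1.
Qed.

(** Raising the truncation level from [K] to [2 * K] affects only jumps of size at least [K], each
    by at most [4 * K ^+ 2 - K ^+ 2]. *)
Lemma trunc_sq_double N K : 0 < K -> trunc_sq N (2 * K) <=
  trunc_sq N K + 3 * K ^+ 2 * \sum_(k <- zrange N | K <= `|k%:~R|) p k.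
Proof.
move=> K0; rewrite [X in _ + _ * X]big_mkcond mulr_sumr -big_split /=.
apply: ler_sum => k _.
have -> : `|k%:~R : R| = `|k%:~R| by [].
set v : R := k%:~R.
have v2 : v ^+ 2 = `|v| ^+ 2 by rewrite real_normK ?num_real.
case: ifPn => [Kv|]; last first.
  rewrite -ltNge => vK; rewrite mulr0 addr0 ler_wpM2l // le_min ge_min lexx /=.
  rewrite ge_min; apply/orP; left.
  by rewrite v2 ler_pXn2r ?nnegrE ?normr_ge0 ?(ltW K0) // ltW.
rewrite [_ * p k]mulrC -mulrDr ler_wpM2l //.
rewrite (_ : Num.min (v ^+ 2) (K ^+ 2) = K ^+ 2); last first.
  apply/min_idPr; rewrite v2 ler_pXn2r ?nnegrE ?normr_ge0 ?(ltW K0) //.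
by rewrite ge_min; apply/orP; right; rewrite exprMn; lra.
Qed.

(** A nonnegative exponent, still below 2, makes powers monotone in the base. *)
Let c0 : R := Num.max c 0.
Let c00 : 0 <= c0. Proof. by rewrite /c0 le_max lexx orbT. Qed.
Let c02 : c0 < 2. Proof. by rewrite /c0 gt_max c2 /=. Qed.
(** Ratio of successive weights in [powR_le_sum]. *)
Let q : R := 2 `^ (c0 - 2).
Let q0 : 0 < q. Proof. exact: powR_gt0. Qed.
Let q1 : q < 1.
Proof.
rewrite lt_neqAle -[leRHS](powRr0 2) ler_powR ?ler1n ?subr_le0 ?(ltW c02) //.
rewrite powR_eq1 gt_eqF ?ltr1n // ltNge ler0n /= andbT subr_eq0.
by rewrite lt_eqF // c02.
Qed.

(** With light tails at every scale, passing from [8 * L] to [16 * L] adds at most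
    [3 * (8 * L) ^+ 2 * kappa * theta], that is [192 * kappa] times the truncated second moment at
    [L], which is at most the one at [8 * L]. The threshold [N0] depends on [J] because only
    finitely many scales can be handled by one [N]. *)
Let scale_growth (kappa m : R) : 0 < kappa -> 1 <= m ->
  (forall L, m <= L -> exists N0, forall N, (N0 <= N)%N ->
    \sum_(k <- zrange N | 8 * L <= `|k%:~R|) p k <=
    kappa * trunc_theta p (zrange N) L) ->
  forall J, exists N0, forall N, (N0 <= N)%N -> forall j, (j <= J)%N ->
    trunc_sq N (2 ^+ j * (8 * m)) <= (1 + 192%:R * kappa) ^+ j * (8 * m) ^+ 2.
Proof.
move=> k0 m1 H; have m0 : 0 < m by exact: lt_le_trans m1.
elim=> [|J [N0 IH]].
  exists 0%N => N _ j; rewrite leqn0 => /eqP ->; rewrite !expr0 !mul1r.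
  apply: (@le_trans _ _ (\sum_(k <- zrange N) p k * (8 * m) ^+ 2)).
    by apply: ler_sum => k _; rewrite ler_wpM2l // ge_min lexx orbT.
  by rewrite -mulr_suml -[leRHS]mul1r ler_wpM2r // sqr_ge0.
have mJ : m <= 2 ^+ J * m by rewrite ler_peMl ?(ltW m0) // exprn_ege1 // ler1n.
have [N1 HN1] := H _ mJ.
exists (maxn N0 N1) => N; rewrite geq_max => /andP[NN0 NN1] j.
rewrite leq_eqVlt => /orP[/eqP ->|]; last by rewrite ltnS; exact: IH.
set L := 2 ^+ J * m in mJ HN1.
have L0 : 0 < L by exact: lt_le_trans mJ.
have -> : 2 ^+ J.+1 * (8 * m) = 2 * (8 * L) by rewrite exprS /L; ring.
have L80 : 0 < 8 * L by rewrite mulr_gt0.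
apply: le_trans (trunc_sq_double N L80) _.
have IHJ := IH _ NN0 J (leqnn _).
rewrite (_ : 2 ^+ J * (8 * m) = 8 * L) in IHJ; last by rewrite /L; ring.
have := HN1 _ NN1.
have mono : trunc_sq N L <= trunc_sq N (8 * L).
  apply: ler_sum => k _; rewrite ler_wpM2l // le_min ge_min lexx /= ge_min.
  apply/orP; right; rewrite ler_pXn2r ?nnegrE ?(ltW L0) ?(ltW L80) //; lra.
rewrite trunc_sqE // in mono.
set Q := \sum_(_ <- _ | _) _ => HQ.
have L2 : 0 <= 3 * (8 * L) ^+ 2 by rewrite mulr_ge0 ?sqr_ge0.
have h2 := ler_wpM2l L2 HQ.
have k1 : 0 <= 192%:R * kappa by rewrite mulr_ge0 ?ler0n ?(ltW k0).
have h1 := ler_wpM2l k1 mono.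
have h3 := ler_wpM2l (addr_ge0 ler01 k1) IHJ.
rewrite [in leRHS]exprS -[leRHS]mulrA.
apply: le_trans h3; rewrite [leRHS]mulrDl mul1r lerD2l.
apply: le_trans h2 (le_trans _ h1).
by rewrite le_eqVlt; apply/orP; left; apply/eqP; ring.
Qed.

Let powR_sqr (x : R) : 0 < x -> x `^ c0 = x `^ (c0 - 2) * x ^+ 2.
Proof.
move=> x0; rewrite -powR_mulrn ?(ltW x0) // -powRD ?subrK //.
by apply/implyP => _; rewrite gt_eqF.
Qed.

(** Dyadic decomposition: at the largest scale [2 ^+ j * m] below [|k|] the minimum is the squared
    scale, and the [j]-th term equals [(2 * (2 ^+ j * m))]^ c0[, which dominates]|k| [^ c0]. This
    bounds the moment by truncated second moments. *)
Let powR_le_sum (m : R) (k : int) J : 1 <= m -> `|k%:~R| <= 2 ^+ J * m ->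
  (`|k|%:~R : R) `^ c <= 1 + m `^ c0 + \sum_(j < J)
    2 `^ c0 * (q ^+ j * m `^ (c0 - 2)) * Num.min (k%:~R ^+ 2) ((2 ^+ j * m) ^+ 2).
Proof.
move=> m1; have m0 : 0 < m by exact: lt_le_trans m1.
rewrite intr_norm; set v : R := `|k%:~R|.
have v01 : v = 0 \/ 1 <= v.
  rewrite /v -intr_norm; have [->|k0] := eqVneq k 0; [left|right].
    by rewrite normr0.
  by rewrite ler1z; lia.
(* At [v = 0] the power is 0 for nonzero [c] but 1 for [c = 0], hence the summand 1; otherwise the
   integer size is at least 1 and the power grows with the exponent. *)
have vc : v `^ c <= 1 + v `^ c0.
  case: v01 => [->|v1].
    have [->|cn0] := eqVneq c 0; first by rewrite powRr0 lerDl powR_ge0.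
    by rewrite powR0 // addr_ge0 // powR_ge0.
  rewrite -[leLHS]add0r lerD // ler_powR // /c0 le_max lexx //.
have v0 : 0 <= v by rewrite /v.
move=> vJ; apply: le_trans vc _; rewrite -addrA lerD2l.
elim: J vJ => [|J IH] vJ.
  rewrite big_ord0 addr0 ge0_ler_powR ?nnegrE ?(ltW m0) //.
  by move: vJ; rewrite expr0 mul1r.
rewrite big_ord_recr /= addrA.
set last := _ * Num.min _ _.
have last0 : 0 <= last.
  rewrite /last mulr_ge0 ?le_min ?sqr_ge0 //.
  by rewrite !mulr_ge0 ?powR_ge0 ?exprn_ge0 // ltW.
have [/IH H|H] := lerP v (2 ^+ J * m).
  by apply: le_trans H _; rewrite lerDl.
have -> : last = (2 * (2 ^+ J * m)) `^ c0.
  have K0 : 0 < 2 ^+ J * m by rewrite mulr_gt0 ?exprn_gt0.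
  rewrite /last (_ : Num.min _ _ = (2 ^+ J * m) ^+ 2); last first.
    apply/min_idPr; rewrite -[leRHS]real_normK ?num_real //.
    by rewrite ler_pXn2r ?nnegrE ?normr_ge0 ?(ltW K0) // -/v ltW.
  rewrite powRM ?(ltW K0) // -mulrA; congr (_ * _).
  rewrite [RHS]powRM ?exprn_ge0 ?(ltW m0) // exprMn mulrACA; congr (_ * _).
    rewrite [RHS]powR_sqr ?exprn_gt0 //; congr (_ * _).
    have H2 : 0 <= 2 :> R by [].
    rewrite /q -(powR_mulrn J (powR_ge0 _ _)) -(powR_mulrn J H2).
    by rewrite -!powRrM mulrC.
  by rewrite -powR_sqr.
have Hv : v `^ c0 <= (2 * (2 ^+ J * m)) `^ c0.
  apply: ge0_ler_powR => //; rewrite ?nnegrE ?mulr_ge0 ?exprn_ge0 ?(ltW m0) //.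
  by rewrite mulrA -exprS.
apply: le_trans Hv _; rewrite lerDr addr_ge0 ?powR_ge0 // sumr_ge0 // => j _.
rewrite mulr_ge0 ?le_min ?sqr_ge0 //.
by rewrite !mulr_ge0 ?powR_ge0 ?exprn_ge0 // ltW.
Qed.

(** Otherwise [scale_growth] holds from some scale on, and inserting it in [powR_le_sum] bounds the
    partial sums of the [c]-th moment by a convergent geometric series. The tail inequality is
    claimed for arbitrarily large [N] only, which is the negation of an eventual bound. *)
Lemma heavy_scale : exists2 kappa : R, 0 < kappa &
  forall M : R, exists L : R, [/\ M <= L, 1 <= L & forall N0 : nat,
    exists2 N, (N0 <= N)%N &
      kappa * trunc_theta p (zrange N) L <
      \sum_(k <- zrange N | 8 * L <= `|k%:~R|) p k].
Proof.
(* Then [q * (1 + 192 * kappa) = q * (3 - q) / 2], which is below 1 because [q < 1]. *)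
pose kappa := (1 - q) / 384%:R.
have k0 : 0 < kappa by rewrite divr_gt0 ?subr_gt0 ?ltr0n.
exists kappa => // M; apply: contrapT => noL.
pose m := Num.max M 1.
have m1 : 1 <= m by rewrite le_max lexx orbT.
have m8 : 1 <= 8 * m by lra.
have H L : m <= L -> exists N0, forall N, (N0 <= N)%N ->
    \sum_(k <- zrange N | 8 * L <= `|k%:~R|) p k <=
    kappa * trunc_theta p (zrange N) L.
  rewrite ge_max => /andP[ML L1]; apply: contrapT => noN; apply: noL.
  exists L; split => // N0; apply: contrapT => noN1; apply: noN.
  exists N0 => N N0N; rewrite leNgt; apply/negP => HN; apply: noN1.
  by exists N.
have growth := scale_growth k0 m1 H.
pose q' := q * (1 + 192%:R * kappa).
have q'0 : 0 <= q'.
  exact: mulr_ge0 (ltW q0) (addr_ge0 ler01 (mulr_ge0 (ler0n _ _) (ltW k0))).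
have q'1 : q' < 1.
  rewrite /q' /kappa; have := q0; have := q1; nra.
pose W := 8 * m.
have W0 : 0 < W by exact: lt_le_trans m8.
have [N1] := pc (1 + W `^ c0 + 2 `^ c0 * W `^ c0 / (1 - q')).
apply/negP; rewrite -leNgt.
(* Enough dyadic scales to reach every jump of [zrange N1], where the moment is already too large;
   the range is then enlarged to [N] so that [growth] applies to all of them. *)
have [J NJ] : exists J, N1%:R <= 2 ^+ J * W.
  exists N1; rewrite -[leLHS]mulr1 ler_pM //.
  by rewrite -natrX ler_nat ltnW // ltn_expl.
have [N0 HN0] := growth J.
pose N := maxn N0 N1.
have HN := HN0 N (leq_maxl _ _).
pose wt (k : int) : R := 1 + W `^ c0 + \sum_(j < J)
    2 `^ c0 * (q ^+ j * W `^ (c0 - 2)) * Num.min (k%:~R ^+ 2) ((2 ^+ j * W) ^+ 2).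
have co0 (j : nat) : 0 <= 2 `^ c0 * (q ^+ j * W `^ (c0 - 2)).
  by rewrite !mulr_ge0 ?powR_ge0 ?exprn_ge0 // ltW.
have wt0 k : 0 <= wt k.
  rewrite addr_ge0 ?addr_ge0 ?powR_ge0 // sumr_ge0 // => j _.
  by rewrite mulr_ge0 ?le_min ?sqr_ge0.
apply: (@le_trans _ _ (\sum_(k <- zrange N1) p k * wt k)).
  rewrite big_seq [leRHS]big_seq; apply: ler_sum => k; rewrite mem_zrange => kN.
  rewrite mulrC ler_wpM2l // powR_le_sum //.
  apply: le_trans NJ; rewrite -intr_norm.
  by rewrite -[N1%:R]/((N1%:Z)%:~R) ler_int.
apply: (@le_trans _ _ (\sum_(k <- zrange N) p k * wt k)).
  by apply: ler_sum_zrange; [exact: leq_maxr | move=> k; rewrite mulr_ge0].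
rewrite /wt; under eq_bigr do rewrite mulrDr mulr_sumr.
rewrite big_split /= -mulr_suml lerD //.
  by rewrite -[leRHS]mul1r ler_wpM2r // addr_ge0 // powR_ge0.
rewrite exchange_big /=.
apply: (@le_trans _ _ (\sum_(j < J) 2 `^ c0 * W `^ c0 * q' ^+ j)).
  apply: ler_sum => j _.
  have := ler_wpM2l (co0 j) (HN j (ltnW (ltn_ord j))).
  rewrite mulr_sumr => HH; apply: le_trans (le_trans _ HH) _.
    by apply: ler_sum => k _; rewrite mulrCA.
  rewrite [q' ^+ j]exprMn -/W.
  rewrite (powR_sqr W0).
  by rewrite le_eqVlt; apply/orP; left; apply/eqP; ring.
rewrite -mulr_sumr ler_wpM2l ?mulr_ge0 ?powR_ge0 //.
have := subrX1 q' J; rewrite -opprB => HJ.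
rewrite -[leRHS]div1r ler_pdivlMr ?subr_gt0 //.
have : 0 <= q' ^+ J by rewrite exprn_ge0.
by move: HJ; set sm := \sum_(_ < _) _ => HJ ?; lra.
Qed.

End heavy_scales.

(** * Dual paths *)

Section dual_paths.
Context {R : realType}.
Implicit Types (tau : int -> nat -> R) (Y : int -> nat -> int).

(** Recursive form of [bwd_ends]: [l] lists the indices of the arrivals met going down from time
    [s], so that induction applies and paths are countable. *)
Fixpoint dual_path tau Y (x : int) (s : R) (l : seq nat) (y : int) : Prop :=
  if l is k :: l' then
    [/\ 0 < evt tau x k < s, (forall j, 0 < evt tau x j < s -> (j <= k)%N)
      & dual_path tau Y (x + Y x k) (evt tau x k) l' y]
  else x = y /\ forall j, ~ (0 < evt tau x j < s).

Lemma bwd_endsP tau Y x s y :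
  bwd_ends tau Y x s y <-> exists l, dual_path tau Y x s l y.
Proof.
split=> [[n]|[l]].
  elim: n x s => [|n IH] x s [zs [ks [ss [zx sx zy step last]]]].
    exists [::] => /=; rewrite -zx -sx; split => //.
  have [|l pl] := IH (zs 1%N) (ss 1%N).
    exists (zs \o S), (ks \o S), (ss \o S); split => //= i ni.
    exact: (step i.+1).
  have [s1 s2 s3 s4] := step 0%N isT.
  exists (ks 0%N :: l) => /=; rewrite -zx -sx; split => //.
  by rewrite -s2 -s4.
elim: l x s => [|k l IH] x s /=.
  move=> [-> H]; exists 0%N, (fun=> y), (fun=> 0%N), (fun=> s); split => //.
move=> [H1 H2] /IH[n [zs [ks [ss [zx sx zy step last]]]]].
exists n.+1, (fun i => if i is i'.+1 then zs i' else x),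
  (fun i => if i is i'.+1 then ks i' else k),
  (fun i => if i is i'.+1 then ss i' else s); split => //.
by move=> [|i] /=; [rewrite zx sx | exact: step].
Qed.

Lemma dual_path_inj tau Y x s l l' y y' :
  dual_path tau Y x s l y -> dual_path tau Y x s l' y' -> y = y'.
Proof.
elim: l l' x s => [|k l IH] [|k' l'] x s /=.
- by move=> [-> _] [-> _].
- by move=> [_ /(_ k')H] [/H].
- by move=> [H _ _] [_ /(_ k)/(_ H)].
- move=> [H1 H2 p1] [H1' H2' p2].
  have kk : k = k' by apply/eqP; rewrite eqn_leq H2' // H2.
  by move: p2; rewrite -kk; exact: IH p1.
Qed.

Definition same_before (s : R) tau tau' Y Y' := forall z i,
  0 < evt tau z i < s \/ 0 < evt tau' z i < s ->
  evt tau z i = evt tau' z i /\ Y z i = Y' z i.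

Lemma same_before_sym s tau tau' Y Y' :
  same_before s tau tau' Y Y' -> same_before s tau' tau Y' Y.
Proof. by move=> H z i /or_comm/H[-> ->]. Qed.

Lemma dual_path_same s tau tau' Y Y' x s' l y : same_before s tau tau' Y Y' ->
  s' <= s -> dual_path tau Y x s' l y -> dual_path tau' Y' x s' l y.
Proof.
move=> H; elim: l x s' => [|k l IH] x s' s's /=.
  move=> [xy nj]; split => // j /andP[j0 js]; apply: (nj j).
  by have [|-> _] := H x j; [right; rewrite j0 (lt_le_trans js) | rewrite j0].
move=> [/andP[k0 ks] kmax pl].
have [|ek Yk] := H x k; first by left; rewrite k0 (lt_le_trans ks).
rewrite -ek -Yk; split; first by rewrite k0.
  move=> j /andP[j0 js]; apply: kmax.
  by have [|-> _] := H x j; [right; rewrite j0 (lt_le_trans js) | rewrite j0].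
by apply: IH pl; apply: le_trans s's; exact: ltW.
Qed.

Lemma dual_path_extend tau Y x s s' l y : s <= s' ->
  (forall i, ~ (s <= evt tau x i < s')) ->
  dual_path tau Y x s l y -> dual_path tau Y x s' l y.
Proof.
move=> ss' quiet.
have lt' i : evt tau x i < s' -> evt tau x i < s.
  by move=> H; rewrite ltNge; apply/negP => H'; apply: (quiet i); rewrite H'.
case: l => [|k l] /=.
  by move=> [<- nj]; split => // j /andP[j0 js]; apply: (nj j); rewrite j0 (lt' _ js).
move=> [/andP[k0 ks] kmax pl]; split => //.
  by rewrite k0 (lt_le_trans ks).
by move=> j /andP[j0 js]; apply: kmax; rewrite j0 (lt' _ js).
Qed.

(** Time of the arrival just before the one of index [j], and 0 for [j = 0]; thus it does not
    involve [tau x j]. *)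
Definition arrival tau x j : R := \sum_(i < j) tau x i.

Lemma evtE tau x j : evt tau x j = arrival tau x j + tau x j.
Proof. by rewrite /evt big_ord_recr. Qed.

(** The disjunct [j == 0] makes this meaningful at [s = 0] as well. *)
Definition count_before tau x (s : R) j :=
  ((j == 0%N) \/ 0 <= arrival tau x j < s) /\ s <= evt tau x j.

Definition positive tau := forall z i, 0 < tau z i.

Lemma arrival_ge0 tau x j : positive tau -> 0 <= arrival tau x j.
Proof. by move=> tau0; apply: sumr_ge0 => i _; rewrite ltW. Qed.

Lemma arrival_le tau x i j : positive tau -> (i <= j)%N ->
  arrival tau x i <= arrival tau x j.
Proof.
move=> tau0 /subnKC <-; elim: (j - i)%N => [|k IH]; first by rewrite addn0.
apply: le_trans IH _; rewrite addnS /arrival big_ord_recr /= lerDl ltW //.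
Qed.

Lemma evt_gt0 tau x j : positive tau -> 0 < evt tau x j.
Proof. by move=> tau0; rewrite evtE ltr_wpDl // arrival_ge0. Qed.

Lemma evt_le tau x i j : positive tau -> (i <= j)%N ->
  evt tau x i <= evt tau x j.
Proof. by move=> tau0 ij; exact: (@arrival_le tau x i.+1 j.+1). Qed.

Lemma count_before_lt tau x s i j : positive tau ->
  count_before tau x s j -> (i < j)%N -> evt tau x i < s.
Proof.
move=> tau0 [[/eqP -> //|/andP[_ js] _] ij].
by apply: le_lt_trans js; exact: (@arrival_le tau x i.+1 j).
Qed.

Lemma count_before_ge tau x s i j : positive tau ->
  count_before tau x s j -> (j <= i)%N -> s <= evt tau x i.
Proof. by move=> tau0 [_ sj] ji; apply: le_trans sj _; exact: evt_le. Qed.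

Lemma count_before_inj tau x s i j : positive tau ->
  count_before tau x s i -> count_before tau x s j -> i = j.
Proof.
move=> tau0 ci cj; have [H|H|//] := ltngtP i j.
  by have := count_before_lt tau0 cj H; have [_] := ci; rewrite leNgt => /negP.
by have := count_before_lt tau0 ci H; have [_] := cj; rewrite leNgt => /negP.
Qed.

Lemma count_before_exists tau x s : positive tau ->
  (exists j, s <= evt tau x j) -> exists j, count_before tau x s j.
Proof.
move=> tau0 ex; case: (ex_minnP ex) => j sj jmin; exists j; split => //.
case: j sj jmin => [|j] sj jmin; [by left | right].
rewrite arrival_ge0 //= ltNge; apply/negP => H.
by have := jmin j H; rewrite ltnn.
Qed.

(** Pushes the arrivals at [x] from the [j]-th on beyond time [s], so that events
    evaluated on the result are independent of them. *)
Definition erase_tau x j (s : R) tau z i : R :=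
  if (z == x) && (j <= i)%N then s + 1 else tau z i.
Definition erase_Y x j Y z i : int :=
  if (z == x) && (j <= i)%N then 0 else Y z i.

Lemma arrival_erase x j s tau i : (i <= j)%N ->
  arrival (erase_tau x j s tau) x i = arrival tau x i.
Proof.
move=> ij; apply: eq_bigr => k _; rewrite /erase_tau eqxx /= leqNgt.
by rewrite (leq_trans (ltn_ord k) ij).
Qed.

(** With [erase_YK], shows that an event ignoring the arrivals from the [j]-th on also ignores those
    from the next one on; [rings_lower] needs this to detach [tau x j.+1]. *)
Lemma erase_tauK x j s tau :
  erase_tau x j s (erase_tau x j.+1 s tau) = erase_tau x j s tau.
Proof.
apply/funext => z; apply/funext => i; rewrite /erase_tau.
by case: (z == x) => //=; case: ltngtP.
Qed.

Lemma erase_YK x j Y : erase_Y x j (erase_Y x j.+1 Y) = erase_Y x j Y.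
Proof.
apply/funext => z; apply/funext => i; rewrite /erase_Y.
by case: (z == x) => //=; case: ltngtP.
Qed.

(** The arrivals from the [j]-th on come at or after [s] in the given field, and after it in the
    erased one, whose waiting times there are [s + 1]. *)
Lemma erase_same_before tau Y x j s : positive tau -> 0 <= s ->
  count_before tau x s j ->
  same_before s tau (erase_tau x j s tau) Y (erase_Y x j Y).
Proof.
move=> tau0 s0 cj z i; have [->|zx] := eqVneq z x; last first.
  by rewrite /evt /erase_tau /erase_Y (negbTE zx).
have [ij|ji] := ltnP i j.
  rewrite -[evt _ _ _]/(arrival _ x i.+1) -[evt (erase_tau _ _ _ _) _ _]/(arrival _ x i.+1).
  by rewrite arrival_erase // /erase_Y eqxx leqNgt ij.
case=> /andP[_]; rewrite ltNge => /negP[].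
  exact: count_before_ge cj ji.
rewrite evtE {2}/erase_tau eqxx ji /= -[leLHS]add0r lerD ?lerDl //.
apply: sumr_ge0 => k _; rewrite /erase_tau; case: ifP => _; last exact: ltW.
by rewrite addr_ge0.
Qed.

Definition ends_in (H : pred int) (s : R) x tau Y :=
  exists l y, dual_path tau Y x s l y /\ H y.

Definition quiet (x : int) (s h : R) tau Y := forall i, ~ (s <= evt tau x i < s + h).

(** The condition on [tau x j.+1] excludes a second arrival in the step; it is put on a single
    waiting time so that independence applies directly. *)
Definition rings (x k : int) (s h : R) tau Y := exists j,
  [/\ count_before tau x s j, evt tau x j < s + h, h <= tau x j.+1 & Y x j = k].

Lemma ends_in_quiet H s h x tau Y : 0 <= h -> ends_in H s x tau Y ->
  quiet x s h tau Y -> ends_in H (s + h) x tau Y.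
Proof.
move=> h0 [l [y [pl Hy]]] q; exists l, y; split => //.
by apply: dual_path_extend pl => //; rewrite lerDl.
Qed.

(** Going down from [s + h], the path meets arrival [j], jumps to [x + k], and meets nothing more
    before [s]: that site is quiet, or, if [k = 0], it is [x] itself and [j] is its first arrival
    from [s] on. *)
Lemma ends_in_rings H s h x k tau Y : positive tau ->
  rings x k s h tau Y -> ends_in H s (x + k) tau Y ->
  (k != 0 -> quiet (x + k) s h tau Y) -> ends_in H (s + h) x tau Y.
Proof.
move=> tau0 [j [cj jsh hj Yj]] [l [y [pl Hy]]] q.
exists (j :: l), y; split => //=; split.
- by rewrite evt_gt0.
- move=> i /andP[_ ish]; rewrite leqNgt; apply/negP => ji.
  have := evt_le x tau0 ji; rewrite leNgt => /negP; apply.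
  apply: (lt_le_trans ish); rewrite [leRHS]evtE lerD //.
  by have [_] := cj; rewrite -[arrival _ _ _]/(evt tau x j).
rewrite Yj; apply: dual_path_extend pl; first by case: cj.
move=> i /andP[si ij].
have [k0|k0] := eqVneq k 0.
  rewrite k0 addr0 in si ij.
  have [H1|H1] := ltnP i j.
    by have := count_before_lt tau0 cj H1; rewrite ltNge si.
  by have := evt_le x tau0 H1; rewrite leNgt ij.
by apply: (q k0 i); rewrite si (lt_trans ij).
Qed.

Lemma quiet_not_rings x k s h tau Y : quiet x s h tau Y -> ~ rings x k s h tau Y.
Proof. by move=> q [j [[_ sj] jsh _ _]]; apply: (q j); rewrite sj. Qed.

Lemma rings_inj x k k' s h tau Y : positive tau ->
  rings x k s h tau Y -> rings x k' s h tau Y -> k = k'.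
Proof.
move=> tau0 [j [cj _ _ <-]] [j' [cj' _ _ <-]].
by rewrite (count_before_inj tau0 cj cj').
Qed.

Lemma count_before_quiet x j s h tau Y : positive tau ->
  count_before tau x s j -> s + h <= evt tau x j -> quiet x s h tau Y.
Proof.
move=> tau0 cj sj i /andP[si ish].
have [H|H] := ltnP i j.
  by have := count_before_lt tau0 cj H; rewrite ltNge si.
by have := le_trans sj (evt_le x tau0 H); rewrite leNgt ish.
Qed.

End dual_paths.

(** * Measurability and locality of events of the random fields *)

Section field_predicates.
Context {R : realType}.

Definition field_pred := (int -> nat -> R) -> (int -> nat -> int) -> Prop.

Definition measurable_fields d (T : measurableType d)
    (tau : int -> nat -> T -> R) (Y : int -> nat -> T -> int) :=
  (forall z k, measurable_fun setT (tau z k)) /\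
  (forall z k w, measurable (Y z k @^-1` [set w])).

Definition field_event d (T : measurableType d) (tau : int -> nat -> T -> R)
    (Y : int -> nat -> T -> int) (Phi : field_pred) : set T :=
  [set om | Phi (fun z k => tau z k om) (fun z k => Y z k om)].

Local Notation holds := field_event.

(** Quantifying over all measurable spaces lets the same fact be used for the
    full sigma-algebra and for the sub-sigma-algebras that ignore one index. *)
Definition mpred (Phi : field_pred) := forall d (T : measurableType d) tau Y,
  @measurable_fields d T tau Y -> measurable (holds tau Y Phi).

Definition mreal (f : (int -> nat -> R) -> (int -> nat -> int) -> R) :=
  forall d (T : measurableType d) tau Y, @measurable_fields d T tau Y ->
    measurable_fun setT (fun om => f (fun z k => tau z k om) (fun z k => Y z k om)).

Lemma mpred_ext (Phi Psi : field_pred) :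
  (forall tau Y, Phi tau Y <-> Psi tau Y) -> mpred Phi -> mpred Psi.
Proof.
move=> PP mP d T tau Y mtY; rewrite (_ : holds _ _ _ = holds tau Y Phi) //.
  exact: mP.
by apply/seteqP; split => om /=; rewrite /field_event /= => /PP.
Qed.

Lemma mpred_cst (Q : Prop) : mpred (fun _ _ => Q).
Proof.
move=> d T tau Y _; have [q|q] := pselect Q.
  by rewrite (_ : holds _ _ _ = setT) //; apply/seteqP; split.
by rewrite (_ : holds _ _ _ = set0) //; apply/seteqP; split.
Qed.

Lemma mpred_and Phi Psi : mpred Phi -> mpred Psi ->
  mpred (fun tau Y => Phi tau Y /\ Psi tau Y).
Proof. by move=> m1 m2 d T tau Y H; apply: measurableI; [exact: m1|exact: m2]. Qed.

Lemma mpred_or Phi Psi : mpred Phi -> mpred Psi ->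
  mpred (fun tau Y => Phi tau Y \/ Psi tau Y).
Proof. by move=> m1 m2 d T tau Y H; apply: measurableU; [exact: m1|exact: m2]. Qed.

Lemma mpred_not Phi : mpred Phi -> mpred (fun tau Y => ~ Phi tau Y).
Proof. by move=> m1 d T tau Y H; apply: measurableC; exact: m1. Qed.

Lemma mpred_exists (I : countType) (Phi : I -> field_pred) :
  (forall i, mpred (Phi i)) -> mpred (fun tau Y => exists i, Phi i tau Y).
Proof.
move=> mP d T tau Y H.
rewrite (_ : holds _ _ _ = \bigcup_i holds tau Y (Phi i)).
  by apply: countable_bigcupT_measurable => // i; exact: mP.
by apply/seteqP; split => [om [i Pi]|om [i _ Pi]]; exists i.
Qed.

Lemma mpred_forall (I : countType) (Phi : I -> field_pred) :
  (forall i, mpred (Phi i)) -> mpred (fun tau Y => forall i, Phi i tau Y).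
Proof.
move=> mP; apply: (mpred_ext (Phi := fun tau Y => ~ exists i, ~ Phi i tau Y)).
  by move=> tau Y; split => [H i|H [i]//]; apply: contrapT => nP; apply: H; exists i.
by apply: mpred_not; apply: mpred_exists => i; exact: mpred_not.
Qed.

Lemma mpred_imply Phi Psi : mpred Phi -> mpred Psi ->
  mpred (fun tau Y => Phi tau Y -> Psi tau Y).
Proof.
move=> m1 m2; apply: (mpred_ext (Phi := fun tau Y => ~ Phi tau Y \/ Psi tau Y)).
  by move=> tau Y; split => [[]//|H]; have [?|?] := pselect (Phi tau Y); [right|left]; auto.
by apply: mpred_or => //; exact: mpred_not.
Qed.

Lemma mpred_lt f g : mreal f -> mreal g -> mpred (fun tau Y => f tau Y < g tau Y).
Proof.
move=> mf mg d T tau Y H.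
have := measurable_fun_ltr (mf _ _ _ _ H) (mg _ _ _ _ H).
by move=> /(_ measurableT [set true] I); rewrite setTI.
Qed.

Lemma mpred_le f g : mreal f -> mreal g -> mpred (fun tau Y => f tau Y <= g tau Y).
Proof.
move=> mf mg d T tau Y H.
have := measurable_fun_ler (mf _ _ _ _ H) (mg _ _ _ _ H).
by move=> /(_ measurableT [set true] I); rewrite setTI.
Qed.

Lemma mpred_Y z k (w : int) : mpred (fun _ Y => Y z k = w).
Proof. by move=> d T tau Y [_ mY]; exact: mY. Qed.

Lemma mreal_cst a : mreal (fun _ _ => a).
Proof. by move=> d T tau Y _; exact: measurable_cst. Qed.

Lemma mreal_tau z k : mreal (fun tau _ => tau z k).
Proof. by move=> d T tau Y [mt _]; exact: mt. Qed.

Lemma mpred_positive : mpred (fun tau _ => positive tau).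
Proof.
apply: mpred_forall => z; apply: mpred_forall => i.
by apply: mpred_lt; [exact: mreal_cst | exact: mreal_tau].
Qed.

Lemma mreal_arrival x j : mreal (fun tau _ => arrival tau x j).
Proof.
by move=> d T tau Y [mt _]; exact: (@measurable_sum _ T R setT 'I_j (index_enum _) (fun i om => tau x i om)).
Qed.

Lemma mreal_evt x j : mreal (fun tau _ => evt tau x j).
Proof. exact: mreal_arrival x j.+1. Qed.

Lemma mpred_between a x j b : mreal b ->
  mpred (fun tau Y => a < evt tau x j < b tau Y).
Proof.
move=> mb; apply: (mpred_ext (Phi := fun tau Y => a < evt tau x j /\ evt tau x j < b tau Y)).
  by move=> tau Y; split => [[-> ->]//|/andP[]].
apply: mpred_and; apply: mpred_lt => //; exact: mreal_evt.
Qed.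

(** The starting time is allowed to be random because the induction restarts at [evt tau x k]; the
    random landing site is handled by a countable union over its values. *)
Lemma mpred_dual_path l x s y : mreal s ->
  mpred (fun tau Y => dual_path tau Y x (s tau Y) l y).
Proof.
elim: l x s => [|k l IH] x s ms /=.
  apply: mpred_and; first exact: mpred_cst.
  by apply: mpred_forall => j; apply: mpred_not; exact: mpred_between.
apply: (mpred_ext (Phi := fun tau Y => 0 < evt tau x k < s tau Y /\
  ((forall j, 0 < evt tau x j < s tau Y -> (j <= k)%N) /\
  exists w, Y x k = w /\ dual_path tau Y (x + w) (evt tau x k) l y))).
  move=> tau Y; split => [[? [? [w [-> ?]]]]|[? ? ?]] //.
  by split => //; split => //; exists (Y x k).
apply: mpred_and; first exact: mpred_between.
apply: mpred_and.
  apply: mpred_forall => j; apply: mpred_imply; first exact: mpred_between.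
  exact: mpred_cst.
apply: mpred_exists => w; apply: mpred_and; first exact: mpred_Y.
by apply: IH; exact: mreal_evt.
Qed.

Lemma mpred_ends_in H s x : mpred (ends_in H s x).
Proof.
apply: mpred_exists => l; apply: mpred_exists => y; apply: mpred_and.
  by apply: mpred_dual_path; exact: mreal_cst.
exact: mpred_cst.
Qed.

Lemma mpred_quiet x s h : mpred (quiet x s h).
Proof.
apply: mpred_forall => i; apply: mpred_not.
apply: (mpred_ext (Phi := fun tau Y => s <= evt tau x i /\ evt tau x i < s + h)).
  by move=> tau Y; split => [[-> ->]//|/andP[]].
apply: mpred_and; first by apply: mpred_le; [exact: mreal_cst|exact: mreal_evt].
by apply: mpred_lt; [exact: mreal_evt|exact: mreal_cst].
Qed.

(** The half of [count_before] that depends only on waiting times of index below [j], and so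
    survives erasing. *)
Definition started x (s : R) j : field_pred :=
  fun tau _ => (j == 0%N) \/ 0 <= arrival tau x j < s.

Lemma mpred_started x s j : mpred (started x s j).
Proof.
apply: mpred_or; first exact: mpred_cst.
apply: (mpred_ext (Phi := fun tau Y => 0 <= arrival tau x j /\ arrival tau x j < s)).
  by move=> tau Y; split => [[-> ->]//|/andP[]].
by apply: mpred_and; [apply: mpred_le|apply: mpred_lt];
  do ?[exact: mreal_arrival | exact: mreal_cst].
Qed.

Lemma mpred_count_before x s j : mpred (fun tau _ => count_before tau x s j).
Proof.
apply: mpred_and; first exact: mpred_started.
by apply: mpred_le; [exact: mreal_cst|exact: mreal_evt].
Qed.

Lemma mpred_rings x k s h : mpred (rings x k s h).
Proof.
apply: mpred_exists => j.
apply: (mpred_ext (Phi := fun tau Y => (count_before tau x s j /\ evt tau x j < s + h)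
  /\ (h <= tau x j.+1 /\ Y x j = k))).
  by move=> tau Y; split => [[[? ?] [? ?]]|[? ? ? ?]].
apply: mpred_and; apply: mpred_and.
- exact: mpred_count_before.
- by apply: mpred_lt; [exact: mreal_evt|exact: mreal_cst].
- by apply: mpred_le; [exact: mreal_cst|exact: mreal_tau].
- exact: mpred_Y.
Qed.

Definition erased x j s (Phi : field_pred) : field_pred :=
  fun tau Y => Phi (erase_tau x j s tau) (erase_Y x j Y).

(** Only the coordinates that are kept have to be measurable, so the sigma-algebra may ignore the
    erased ones. *)
Lemma measurable_fields_erase x j s d (T : measurableType d) tau Y :
  (forall z i, ~~ ((z == x) && (j <= i)%N) ->
    measurable_fun setT (tau z i) /\ forall w, measurable (Y z i @^-1` [set w])) ->
  @measurable_fields d T (fun z i om => erase_tau x j s (fun z i => tau z i om) z i)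
    (fun z i om => erase_Y x j (fun z i => Y z i om) z i).
Proof.
move=> H; split => [z i|z i w]; rewrite /erase_tau /erase_Y.
  have [b|/H[]//] := boolP ((z == x) && (j <= i)%N); exact: measurable_cst.
have [b|/H[_ H2]] := boolP ((z == x) && (j <= i)%N); last exact: H2.
have [w0|w0] := eqVneq 0 w.
  by rewrite (_ : _ @^-1` _ = setT) //; apply/seteqP; split.
rewrite (_ : _ @^-1` _ = set0) //; apply/seteqP; split => // om /=.
by apply/eqP.
Qed.

Lemma mpred_erased x j s Phi : mpred Phi -> mpred (erased x j s Phi).
Proof.
move=> mP d T tau Y [mt mY].
by apply: mP; apply: measurable_fields_erase => z i _; split => // w.
Qed.

(** [Phi] depends on the arrivals at [x] only through those before time [s]. *)
Definition local_pred x s (Phi : field_pred) := forall tau Y j, positive tau ->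
  count_before tau x s j -> Phi tau Y <-> erased x j s Phi tau Y.

Lemma local_and x s Phi Psi : local_pred x s Phi -> local_pred x s Psi ->
  local_pred x s (fun tau Y => Phi tau Y /\ Psi tau Y).
Proof.
move=> H1 H2 tau Y j t0 cj; have := H1 tau Y j t0 cj; have := H2 tau Y j t0 cj.
by rewrite /erased; tauto.
Qed.

Lemma local_ends_in x s H y : 0 <= s -> local_pred x s (ends_in H s y).
Proof.
move=> s0 tau Y j t0 cj; have same := erase_same_before Y t0 s0 cj.
split=> -[l [z [pl Hz]]]; exists l, z; split => //; apply: dual_path_same pl => //;
  first [exact: same | exact: same_before_sym same].
Qed.

Lemma evt_erase_neq x y j (s : R) tau i : y != x ->
  evt (erase_tau x j s tau) y i = evt tau y i.
Proof. by move=> yx; rewrite /evt /erase_tau (negbTE yx). Qed.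

Lemma local_quiet x (s : R) y h : y != x -> local_pred x s (quiet y s h).
Proof.
move=> yx tau Y j _ _; rewrite /erased /quiet.
by split=> H i; have := H i; rewrite evt_erase_neq.
Qed.

Lemma local_rings x (s : R) y k h : y != x -> local_pred x s (rings y k s h).
Proof.
move=> yx tau Y j _ _; rewrite /erased /rings /count_before.
by split => -[i]; rewrite ?evt_erase_neq // /arrival /erase_tau /erase_Y (negbTE yx);
  exists i; rewrite ?evt_erase_neq // (negbTE yx).
Qed.

End field_predicates.

(** * Independence and the memoryless property *)

Section real_probability.
Context d (T : measurableType d) (R : realType) (P : probability T R).
Implicit Types A B : set T.

Definition prob A : R := fine (P A).
Local Notation pr := prob.

Lemma pr_fin A : measurable A -> (pr A)%:E = P A.
Proof.
move=> mA; rewrite /prob fineK // ge0_fin_numE ?measure_ge0 //.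
by rewrite (le_lt_trans (probability_le1 P mA)) // ltry.
Qed.

Lemma pr_ge0 A : 0 <= pr A. Proof. exact: fine_ge0. Qed.

Lemma pr_le1 A : measurable A -> pr A <= 1.
Proof. by move=> mA; rewrite -lee_fin pr_fin // probability_le1. Qed.

Lemma pr_le A B : measurable A -> measurable B -> A `<=` B -> pr A <= pr B.
Proof. by move=> mA mB AB; rewrite -lee_fin !pr_fin // le_measure // inE. Qed.

Lemma pr0 : pr set0 = 0. Proof. by rewrite /prob measure0. Qed.
Lemma prT : pr setT = 1. Proof. by rewrite /prob probability_setT. Qed.

Lemma pr_split A B : measurable A -> measurable B ->
  pr A = pr (A `&` B) + pr (A `&` ~` B).
Proof.
move=> mA mB; apply: EFin_inj; rewrite EFinD !pr_fin //.
- by rewrite (measureDI _ mA mB) addeC setDE.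
- by apply: measurableI => //; exact: measurableC.
- exact: measurableI.
Qed.

Lemma sum_pr_le (I : eqType) (s : seq I) (B : I -> set T) A :
  uniq s -> measurable A -> (forall i, measurable (B i)) ->
  (forall i, i \in s -> B i `<=` A) -> (forall i j, B i `&` B j !=set0 -> i = j) ->
  \sum_(i <- s) pr (B i) <= pr A.
Proof.
move=> + + mB + disj; elim: s A => [|i s IH] A /= us mA BA.
  by rewrite big_nil pr_ge0.
move: us => /andP[is_ us]; rewrite big_cons (pr_split mA (mB i)) lerD //.
  apply: pr_le => //; first exact: measurableI.
  by move=> om Bi; split => //; apply: BA Bi; exact: mem_head.
apply: IH => //; first by apply: measurableI => //; exact: measurableC.
move=> j js om Bj; split; first by apply: BA Bj; rewrite inE js orbT.
by move=> Bi; move: is_; rewrite (disj i j) ?js //; exists om.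
Qed.

Lemma pr_ae A B C : measurable A -> measurable B -> measurable C -> pr C = 1 ->
  (forall om, C om -> A om <-> B om) -> pr A = pr B.
Proof.
move=> mA mB mC C1 AB.
have C0 D : measurable D -> pr (D `&` ~` C) = 0.
  move=> mD; apply/eqP; rewrite eq_le pr_ge0 andbT.
  have := pr_split measurableT mC; rewrite prT !setTI C1 => CC.
  have -> : 0 = pr (~` C) by move: CC; lra.
  apply: pr_le; [by apply: measurableI => //; exact: measurableC|exact: measurableC|].
  by move=> om [].
rewrite (pr_split mA mC) (pr_split mB mC) !C0 // !addr0; congr pr.
by apply/seteqP; split => om [H c]; split => //; apply/AB.
Qed.

End real_probability.

Lemma le_expR_lim (R : realType) (x y : R) : 0 <= y ->
  (forall e, 0 < e -> x <= expR e * y) -> x <= y.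
Proof.
move=> y0 H; apply/ler_addgt0Pr => e e0.
have y1 : 0 < y + 1 by lra.
have z0 : 0 < e / (y + 1) by rewrite divr_gt0.
have : 0 < ln (1 + e / (y + 1)) by rewrite ln_gt0 // ltrDl.
move=> /H; rewrite lnK ?posrE ?addr_gt0 // => /le_trans; apply.
rewrite mulrDl mul1r lerD2l mulrAC ler_pdivrMr // ler_pM2l //; lra.
Qed.

Section harris.
Context d (T : measurableType d) (R : realType) (P : probability T R).
Variables (p : int -> R) (tau : int -> nat -> T -> R) (Y : int -> nat -> T -> int).
Hypothesis data : harris_data P p tau Y.

Local Notation pr := (prob P).
Local Notation holds := (field_event tau Y).

Let tau_meas z k : measurable_fun setT (tau z k).
Proof. by case: data. Qed.
Let Y_meas1 z k w : measurable (Y z k @^-1` [set w]).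
Proof. by case: data. Qed.

Lemma harris_fields : measurable_fields tau Y.
Proof. by split. Qed.

Lemma Y_meas z k (B : set int) : measurable (Y z k @^-1` B).
Proof.
rewrite (_ : _ @^-1` _ = \bigcup_w (if `[< B w >] then Y z k @^-1` [set w] else set0)).
  by apply: countable_bigcupT_measurable => // w; case: ifP.
apply/seteqP; split => [om /= Bom|om [w _]].
  by exists (Y z k om) => //; rewrite asboolT.
by case: asboolP => // Bw Yw; rewrite /preimage /= Yw.
Qed.

Lemma tau_meas_set z k (A : set R) : measurable A -> measurable (tau z k @^-1` A).
Proof. by move=> mA; rewrite -[_ @^-1` _]setTI; exact: tau_meas. Qed.

Let rect (i : int * nat) (A : set R) (B : set int) : set T :=
  tau i.1 i.2 @^-1` A `&` Y i.1 i.2 @^-1` B.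

Let rect_meas i A B : measurable A -> measurable (rect i A B).
Proof. by move=> mA; apply: measurableI; [exact: tau_meas_set | exact: Y_meas]. Qed.

(** A pi-system generating the events of all coordinates other than [i0]. *)
Definition cylinder (i0 : int * nat) : set (set T) := [set C |
  exists J A B, [/\ uniq J, i0 \notin J, (forall j, measurable (A j)) &
    C = \bigcap_(j in [set j | j \in J]) rect j (A j) (B j)]].

Lemma cylinder_meas i0 : cylinder i0 `<=` measurable.
Proof.
move=> _ [J [A [B [_ _ mA ->]]]].
rewrite bigcap_seq; apply: bigsetI_measurable => i _; exact: rect_meas.
Qed.

Lemma cylinder_setI i0 : setI_closed (cylinder i0).
Proof.
move=> _ _ [J [A [B [uJ iJ mA ->]]]] [J' [A' [B' [uJ' iJ' mA' ->]]]].
exists (undup (J ++ J')),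
  (fun j => (if j \in J then A j else setT) `&` (if j \in J' then A' j else setT)),
  (fun j => (if j \in J then B j else setT) `&` (if j \in J' then B' j else setT)).
split; first exact: undup_uniq.
- by rewrite mem_undup mem_cat negb_or iJ.
- by move=> j; apply: measurableI; case: ifP.
apply/seteqP; split => om.
  move=> [H H'] j /=; rewrite mem_undup mem_cat => jJ.
  by split; split; case: ifP => // jJ1; [case: (H j jJ1)|case: (H' j jJ1)|
    case: (H j jJ1)|case: (H' j jJ1)].
move=> H; split => j /= jJ.
  have jU : j \in undup (J ++ J') by rewrite mem_undup mem_cat jJ.
  by case: (H j jU) => -[+ _] [+ _]; rewrite jJ.
have jU : j \in undup (J ++ J') by rewrite mem_undup mem_cat jJ orbT.
by case: (H j jU) => -[_ +] [_ +]; rewrite jJ.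
Qed.

(** Uniqueness of finite measures on a pi-system: restricting [P] to [E] and scaling [P] by the mass
    of [E] agree on cylinders, by [harris_independent] for [J] and for [i0 :: J]. *)
Lemma cylinder_indep i0 F A B : <<s cylinder i0 >> F -> measurable A ->
  pr (F `&` rect i0 A B) =
  pr F * (pr (tau i0.1 i0.2 @^-1` A) * pr (Y i0.1 i0.2 @^-1` B)).
Proof.
move=> sF mA; set E := rect i0 A B.
have mE : measurable E by exact: rect_meas.
have [_ _ _ _ indep] := data.
have PE : P E = (pr E)%:E by rewrite pr_fin.
pose c : {nonneg R} := NngNum (pr_ge0 P E).
pose m1 : {measure set T -> \bar R} := mrestr P mE.
pose m2 : {measure set T -> \bar R} := mscale c P.
have cT : cylinder i0 setT.
  exists [::], (fun=> setT), (fun=> setT); split => //.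
  by apply/seteqP; split => // om _ j.
have PEE : P E = (P (tau i0.1 i0.2 @^-1` A) * P (Y i0.1 i0.2 @^-1` B))%E.
  have := indep [:: i0] isT (fun=> A) (fun=> B) (fun=> mA).
  rewrite big_cons big_nil mule1 => <-; congr (P _); apply/seteqP; split => om.
    by move=> H j /=; rewrite inE => /eqP ->.
  by move=> H; apply: (H i0); rewrite /= inE.
have sub : <<s cylinder i0 >> `<=` measurable.
  by apply: smallest_sub; [exact: sigma_algebra_measurable | exact: cylinder_meas].
have m12 : m1 F = m2 F.
  apply: (g_sigma_algebra_measure_unique (cylinder i0) _ (fun=> setT)) sF => //.
  - exact: cylinder_meas.
  - by apply/seteqP; split => // om _; exists 0%N.
  - exact: cylinder_setI.
  - move=> _ [J [A' [B' [uJ iJ mA' ->]]]].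
    rewrite /m1 /m2 /= /mrestr /mscale /= -PE.
    have := indep J uJ A' B' mA'; rewrite -/rect => ->.
    have := indep (i0 :: J) _ (fun j => if j == i0 then A else A' j)
      (fun j => if j == i0 then B else B' j).
    rewrite /= iJ => /(_ uJ) /= H.
    rewrite (_ : _ `&` E = \bigcap_(j in [set j | j \in i0 :: J])
      (tau j.1 j.2 @^-1` (if j == i0 then A else A' j) `&`
       Y j.1 j.2 @^-1` (if j == i0 then B else B' j))); last first.
      apply/seteqP; split => om.
        move=> [H1 H2] j /=; rewrite inE; have [-> _ //|ji /= jJ] := eqVneq j i0.
        exact: H1.
      move=> H1; split; last by have := H1 i0; rewrite /= inE eqxx; apply.
      move=> j /= jJ; have := H1 j; rewrite /= inE jJ orbT => /(_ isT).
      by case: eqP => // ji; move: iJ; rewrite -ji jJ.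
    rewrite H; last by move=> j; case: ifP.
    rewrite big_cons eqxx -PEE; congr (_ * _)%E.
    apply: eq_big_seq => j jJ; case: eqP => // ji.
    by move: iJ; rewrite -ji jJ.
  - move=> _; rewrite /m1 /= /mrestr setTI PE; exact: ltry.
apply: EFin_inj; rewrite !EFinM !pr_fin ?(sub _ sF) //.
- rewrite -PEE; move: m12; rewrite /m1 /m2 /= /mrestr /mscale /= -PE => ->.
  by rewrite muleC.
- exact: Y_meas.
- exact: tau_meas_set.
- exact: sub.
- by apply: measurableI => //; exact: sub.
Qed.

(** [mpred] is applied to the same space with the sigma-algebra generated by [cylinder (x, i)], for
    which the erased fields are still measurable. *)
Lemma erased_cylinder x j s i Phi : mpred Phi -> (j <= i)%N ->
  <<s cylinder (x, i) >> (holds (erased x j s Phi)).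
Proof.
move=> mP ji.
have := mP _ (g_sigma_algebraType (cylinder (x, i)))
  (fun z i om => erase_tau x j s (fun z i => tau z i om) z i)
  (fun z i om => erase_Y x j (fun z i => Y z i om) z i).
apply; apply: measurable_fields_erase => z k zk.
have zi : (x, i) \notin [:: (z, k)].
  rewrite inE; apply/negP => /eqP[xz ik]; move: zk.
  by rewrite -xz -ik eqxx ji.
have cy A B : measurable A ->
    <<s cylinder (x, i) >> (tau z k @^-1` A `&` Y z k @^-1` B).
  move=> mA; apply: sub_sigma_algebra.
  exists [:: (z, k)], (fun=> A), (fun=> B); split => //.
  apply/seteqP; split => [om H l /=|om H]; first by rewrite inE => /eqP ->.
  by apply: (H (z, k)); rewrite /= inE.
split => [_ A mA|w].
  by rewrite setTI; have := cy A setT mA; rewrite preimage_setT setIT.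
by have := cy setT [set w] measurableT; rewrite preimage_setT setTI.
Qed.

Lemma erased_indep x j s i Phi (A : set R) (B : set int) :
  mpred Phi -> (j <= i)%N -> measurable A ->
  pr (holds (erased x j s Phi) `&` (tau x i @^-1` A `&` Y x i @^-1` B)) =
  pr (holds (erased x j s Phi)) * (pr (tau x i @^-1` A) * pr (Y x i @^-1` B)).
Proof.
move=> mP ji mA; apply: (@cylinder_indep (x, i) _ A B _ mA).
exact: erased_cylinder.
Qed.

End harris.

Lemma le_expr_lim (R : realType) (x q : R) : 0 <= q < 1 ->
  (forall n, x <= q ^+ n) -> x <= 0.
Proof.
move=> /andP[q0 q1] H.
have q01 : `|q| < 1 by rewrite ger0_norm.
rewrite leNgt; apply/negP => x0.
have /cvgrPdist_lt/(_ x x0)[n _ /(_ n (leqnn n))] := cvg_expr q01.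
by rewrite /= sub0r normrN ger0_norm ?exprn_ge0 // ltNge H.
Qed.

(** * Exponential clocks: positivity, non-explosion, absence of memory *)

Section harris_markov.
Context d (T : measurableType d) (R : realType) (P : probability T R).
Variables (p : int -> R) (tau : int -> nat -> T -> R) (Y : int -> nat -> T -> int).
Hypothesis data : harris_data P p tau Y.

Local Notation pr := (prob P).
Local Notation holds := (field_event tau Y).

Let fields := harris_fields data.

Lemma holds_meas Phi : mpred Phi -> measurable (holds Phi).
Proof. by move=> /(_ _ _ _ _ fields). Qed.
#[local] Hint Resolve holds_meas : core.

Local Notation tau_ge z k c := [set om | c <= tau z k om].

Lemma tau_geE z k c : tau_ge z k c = tau z k @^-1` `[c, +oo[%classic.
Proof. by apply/seteqP; split => om /=; rewrite in_itv /= andbT. Qed.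

Lemma tau_ge_meas z k c : measurable (tau_ge z k c).
Proof. by rewrite tau_geE; apply: (tau_meas_set data). Qed.

Let pr_tau_gt z k c : 0 <= c -> pr [set om | c < tau z k om] = expR (- c).
Proof. by case: data => _ _ H _ _ /(H z k); rewrite /prob => ->. Qed.

Let tau_gt_meas z k c : measurable [set om | c < tau z k om].
Proof.
rewrite (_ : [set _ | _] = tau z k @^-1` `]c, +oo[%classic).
  exact: (tau_meas_set data).
by apply/seteqP; split => om /=; rewrite in_itv /= andbT.
Qed.

Lemma pr_tau_ge_lower z k c : 0 <= c -> expR (- c) <= pr (tau_ge z k c).
Proof.
move=> c0; rewrite -(pr_tau_gt z k c0); apply: pr_le => //; first exact: tau_ge_meas.
by move=> om /= /ltW.
Qed.

(** The law is given by strict inequalities, so [c] is approached by [c - e]; if [c - e] is negative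
    the bound exceeds 1. *)
Lemma pr_tau_ge_upper z k c : pr (tau_ge z k c) <= expR (- c).
Proof.
apply: le_expR_lim; rewrite ?expR_ge0 // => e e0; rewrite -expRD.
have [ce|ce] := lerP 0 (c - e).
  have -> : e - c = - (c - e) by ring.
  rewrite -(pr_tau_gt z k ce); apply: pr_le => //; first exact: tau_ge_meas.
  by move=> om /=; lra.
apply: (le_trans (pr_le1 _ (tau_ge_meas _ _ _))).
by rewrite -expR0 ler_expR; lra.
Qed.

Lemma pr_Y z k w : pr (Y z k @^-1` [set w]) = p w.
Proof. by case: data => _ _ _ H _; rewrite /prob H. Qed.

Local Notation pos_pred :=
  (fun (tau : int -> nat -> R) (_ : int -> nat -> int) => positive tau).
Let mpred_pos : mpred pos_pred := @mpred_positive R.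

Let pr_eq1 A : measurable A -> (\forall om \ae P, A om) -> pr A = 1.
Proof.
move=> mA H; have mAc : measurable (~` A) by exact: measurableC.
have : P (~` A) = 0.
  by apply/(measure_negligible mAc); exact: H.
move=> H0; have := pr_split P measurableT mA.
by rewrite prT !setTI {2}/prob H0 addr0.
Qed.

Lemma pr_positive : pr (holds pos_pred) = 1.
Proof.
apply: pr_eq1; first exact: holds_meas.
have H : forall n, \forall om \ae P,
    (fun n om => if unpickle n is Some (z, k) then 0 < tau z k om else true) n om.
  move=> n /=; case: (@unpickle (int * nat)%type n) => [[z k]|]; last exact: aeW.
  exists (~` [set om | 0 < tau z k om]); split => //.
    by apply: measurableC; exact: tau_gt_meas.
  have := pr_tau_gt z k (lexx 0); rewrite oppr0 expR0 => H.
  have mA := tau_gt_meas z k 0; have mAc := measurableC mA.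
  rewrite -(pr_fin P mAc); congr EFin.
  by have := pr_split P measurableT mA; rewrite prT !setTI; lra.
apply: filterS (ae_foralln H) => om /= Hom z k.
by have := Hom (pickle (z, k)); rewrite pickleK.
Qed.

(** If no arrival reaches [s], every waiting time is below [s]; for the first [n] of them this has
    probability at most [q ^+ n]. The maximum in [q] covers negative [s]. *)
Lemma pr_no_explosion x s : pr (holds (fun tau _ => exists j, s <= evt tau x j)) = 1.
Proof.
have mE : mpred (fun (tau : int -> nat -> R) (_ : int -> nat -> int) => exists j, s <= evt tau x j).
  apply: mpred_exists => j; apply: mpred_le; [exact: mreal_cst|exact: mreal_evt].
have mH := holds_meas mE.
have mp := holds_meas mpred_pos.
pose q := 1 - expR (- Num.max s 0).
have q01 : 0 <= q < 1.
  rewrite /q subr_ge0 -{1}expR0 ler_expR oppr_le0 le_max lexx orbT /=.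
  by rewrite ltrBlDr ltrDl expR_gt0.
suff : pr (~` holds (fun tau _ => exists j, s <= evt tau x j)) <= 0.
  have := pr_split P measurableT mH; rewrite prT !setTI.
  have := pr_ge0 P (~` holds (fun tau _ => exists j, s <= evt tau x j)).
  by lra.
apply: (le_expr_lim q01) => n.
have lt_meas z k : measurable [set om | tau z k om < s].
  rewrite (_ : [set _ | _] = ~` tau_ge z k s).
    by apply: measurableC; exact: tau_ge_meas.
  by apply/seteqP; split => om /=; rewrite ltNge => /negP.
have [_ _ _ _ indep] := data.
pose J := [seq (x, i) | i <- iota 0 n].
have uJ : uniq J by rewrite map_inj_uniq ?iota_uniq // => i k [].
have := indep J uJ (fun=> `]-oo, s[%classic) (fun=> setT) (fun=> measurable_itv _).
set C := \bigcap_(_ in _) _ => PC.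
have mC : measurable C.
  rewrite /C bigcap_seq; apply: bigsetI_measurable => i _.
  by apply: measurableI; [exact: (tau_meas_set data) | exact: (Y_meas data)].
apply: (@le_trans _ _ (pr C)).
  have -> : pr (~` holds (fun tau _ => exists j, s <= evt tau x j)) =
      pr (~` holds (fun tau _ => exists j, s <= evt tau x j) `&` holds pos_pred).
    apply: (pr_ae (C := holds pos_pred)) => //; last 2 first.
    - exact: pr_positive.
    - by move=> om pom; split => [|[]].
    - exact: measurableC.
    - by apply: measurableI => //; exact: measurableC.
  apply: pr_le => //; first by apply: measurableI => //; exact: measurableC.
  move=> om [/= noexp pos] z /mapP[i _ ->]; split => //=.
  rewrite in_itv /= ltNge; apply/negP => si; apply: noexp; exists i.
  by rewrite evtE; apply: le_trans si _; rewrite lerDr arrival_ge0.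
rewrite /prob PC.
have bnd z k : P (tau z k @^-1` `]-oo, s[%classic) = (1 - pr (tau_ge z k s))%:E.
  rewrite (_ : _ @^-1` _ = ~` tau_ge z k s).
    by rewrite probability_setC ?EFinB ?pr_fin //; exact: tau_ge_meas.
  by apply/seteqP; split => om /=; rewrite in_itv /= ltNge => /negP.
rewrite big_map.
under eq_bigr do rewrite /= bnd preimage_setT probability_setT mule1.
rewrite prodEFin /= -[X in _ <= _ ^+ X](size_iota 0 n).
elim: (iota 0 n) => [|i l IH]; first by rewrite big_nil.
rewrite big_cons exprS ler_pM //.
- by rewrite subr_ge0; exact: pr_le1 (tau_ge_meas _ _ _).
- by apply: prodr_ge0 => k _; rewrite subr_ge0; exact: pr_le1 (tau_ge_meas _ _ _).
rewrite /q lerD2l lerN2; case: (lerP s 0) => s0.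
  apply: (le_trans (pr_tau_ge_lower x i (lexx 0))).
  apply: pr_le; [exact: tau_ge_meas..|].
  by move=> om /= ?; lra.
by apply: pr_tau_ge_lower; exact: ltW.
Qed.

Section memoryless.
Variables (x : int) (j : nat) (s : R) (Phi : @field_pred R).
Hypothesis s0 : 0 <= s.
Hypothesis mPhi : mpred Phi.

Let slice lo hi : @field_pred R := erased x j s (fun tau Y =>
  (Phi tau Y /\ started x s j tau Y) /\ (lo <= arrival tau x j /\ arrival tau x j < hi)).
Let base : @field_pred R := erased x j s (fun tau Y => Phi tau Y /\ started x s j tau Y).

Let mslice_in lo hi : mpred (fun tau Y =>
  (Phi tau Y /\ started x s j tau Y) /\ (lo <= arrival tau x j /\ arrival tau x j < hi)).
Proof.
apply: mpred_and; first by apply: mpred_and => //; exact: mpred_started.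
by apply: mpred_and; [apply: mpred_le|apply: mpred_lt];
  do ?[exact: mreal_arrival | exact: mreal_cst].
Qed.

Let mslice lo hi : mpred (slice lo hi).
Proof. by apply: mpred_erased; exact: mslice_in. Qed.

Definition late a B := [set om | s + a <= evt (fun z k => tau z k om) x j] `&` Y x j @^-1` B.

Lemma late_meas a B : measurable (late a B).
Proof.
apply: measurableI; last exact: (Y_meas data).
apply: (holds_meas (Phi := fun tau _ => s + a <= evt tau x j)).
by apply: mpred_le; [exact: mreal_cst | exact: mreal_evt].
Qed.
Let lm := late_meas.

(** On the slice, [late] forces [tau x j] to be at least [s + a - hi], and the slice is independent
    of [tau x j] and [Y x j]; [slice_lower] uses [lo] in the same way. *)
Let slice_upper lo hi a B : pr (holds (slice lo hi) `&` late a B) <=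
  pr (holds (slice lo hi)) * (expR (- (s + a - hi)) * pr (Y x j @^-1` B)).
Proof.
apply: (@le_trans _ _ (pr (holds (slice lo hi)) *
    (pr (tau_ge x j (s + a - hi)) * pr (Y x j @^-1` B)))).
  rewrite tau_geE -(erased_indep data x s B (mslice_in lo hi) (leqnn j) (measurable_itv _)).
  apply: pr_le.
  - by apply: measurableI => //; exact: (holds_meas (mslice lo hi)).
  - apply: measurableI; first exact: (holds_meas (mslice lo hi)).
    apply: measurableI; [exact: (tau_meas_set data) | exact: (Y_meas data)].
  move=> om [Sl [/= H YB]]; split => //; split => //=.
  move: Sl => [_ [_]]; rewrite arrival_erase // => arr.
  by rewrite in_itv /= andbT; move: H; rewrite evtE /=; lra.
by rewrite ler_wpM2l ?pr_ge0 // ler_wpM2r ?pr_ge0 // pr_tau_ge_upper.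
Qed.

Let slice_lower lo hi a B : lo <= s -> 0 <= a ->
  pr (holds (slice lo hi)) * (expR (- (s + a - lo)) * pr (Y x j @^-1` B)) <=
  pr (holds (slice lo hi) `&` late a B).
Proof.
move=> los a0.
apply: (@le_trans _ _ (pr (holds (slice lo hi)) *
    (pr (tau_ge x j (s + a - lo)) * pr (Y x j @^-1` B)))).
  rewrite ler_wpM2l ?pr_ge0 // ler_wpM2r ?pr_ge0 // pr_tau_ge_lower //; lra.
rewrite tau_geE -(erased_indep data x s B (mslice_in lo hi) (leqnn j) (measurable_itv _)).
apply: pr_le.
- apply: measurableI; first exact: (holds_meas (mslice lo hi)).
  apply: measurableI; [exact: (tau_meas_set data) | exact: (Y_meas data)].
- by apply: measurableI => //; exact: (holds_meas (mslice lo hi)).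
move=> om [Sl [/= H YB]]; split => //; split => //=.
move: Sl => [_ []]; rewrite arrival_erase // => arr _.
by move: H; rewrite in_itv /= andbT evtE; lra.
Qed.

(** Up to the factor [expR e], the ratio of [expR a * pr (Q and late a B)] to the probability of the
    label set [B] depends on neither [a] nor [B]; cross-multiplied, since that probability may
    vanish. *)
Let cmp (Q : set T) e := forall a a' B B', 0 <= a -> 0 <= a' ->
  expR a * pr (Q `&` late a B) * pr (Y x j @^-1` B') <=
  expR e * (expR a' * pr (Q `&` late a' B') * pr (Y x j @^-1` B)).

Let cmp_slice lo e : cmp (holds (slice lo (lo + e))) e.
Proof.
move=> a a' B B' a0 a'0.
have [los|slo] := lerP lo s; last first.
  rewrite (_ : holds _ = set0) ?set0I ?pr0 ?mulr0 ?mul0r ?mulr0 //.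
  apply/seteqP; split => // om [[_ st] [lo1 _]]; move: st lo1.
  rewrite /started; case=> [/eqP -> |/andP[_]]; last by lra.
  by rewrite /arrival big_ord0 => lo0; exfalso; have := s0; lra.
apply: (@le_trans _ _ (expR a * (pr (holds (slice lo (lo + e))) *
   (expR (- (s + a - (lo + e))) * pr (Y x j @^-1` B))) * pr (Y x j @^-1` B'))).
  by rewrite ler_wpM2r ?pr_ge0 // ler_wpM2l ?expR_ge0 // slice_upper.
apply: (@le_trans _ _ (expR e * (expR a' * (pr (holds (slice lo (lo + e))) *
   (expR (- (s + a' - lo)) * pr (Y x j @^-1` B'))) * pr (Y x j @^-1` B)))); last first.
  by rewrite ler_wpM2l ?expR_ge0 // ler_wpM2r ?pr_ge0 // ler_wpM2l ?expR_ge0 // slice_lower.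
rewrite le_eqVlt; apply/orP; left; apply/eqP.
have -> : - (s + a - (lo + e)) = lo + e - s - a by ring.
have -> : - (s + a' - lo) = lo - s - a' by ring.
rewrite !(expRD, expRN); field.
by rewrite !gt_eqF ?expR_gt0.
Qed.

Let slice_split lo mid hi Z : measurable Z -> lo <= mid -> mid <= hi ->
  pr (holds (slice lo hi) `&` Z) =
  pr (holds (slice lo mid) `&` Z) + pr (holds (slice mid hi) `&` Z).
Proof.
move=> mZ lm1 mh.
have mM : mpred (erased x j s (fun tau _ => arrival tau x j < mid)).
  by apply: mpred_erased; apply: mpred_lt; [exact: mreal_arrival|exact: mreal_cst].
rewrite (@pr_split _ _ _ _ _ (holds (erased x j s (fun tau _ => arrival tau x j < mid)))).
- congr (pr _ + pr _); apply/seteqP; split => om.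
  + by move=> [[[H1 [H2 H3]] H4] H5]; split => //; split.
  + move=> [[H1 [H2 H3]] H4]; split => //; split => //; split => //; split => //.
    exact: lt_le_trans H3 mh.
  + move=> [[[H1 [H2 H3]] H4] H5]; split => //; split => //; split => //.
    by rewrite leNgt; apply/negP.
  + move=> [[H1 [H2 H3]] H4]; split; last first.
      by rewrite /field_event /= /erased; apply/negP; rewrite -leNgt.
    by split => //; split => //; split => //; apply: le_trans lm1 H2.
- by apply: measurableI => //; exact: holds_meas.
- exact: holds_meas.
Qed.

Let cmp_slices e m : 0 < e -> cmp (holds (slice 0 (m%:R * e))) e.
Proof.
move=> e0; elim: m => [|m IH] a a' B B' a0 a'0.
  rewrite mul0r (_ : holds _ = set0) ?set0I ?pr0 ?mulr0 ?mul0r ?mulr0 //.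
  by apply/seteqP; split => // om [_ []] /=; lra.
have me : 0 <= m%:R * e by rewrite mulr_ge0 // ltW.
have -> : m.+1%:R * e = m%:R * e + e by rewrite -natr1 mulrDl mul1r.
have me' : m%:R * e <= m%:R * e + e by rewrite lerDl ltW.
rewrite !(slice_split (lm _ _) me me').
have := IH a a' B B' a0 a'0; have := @cmp_slice (m%:R * e) e a a' B B' a0 a'0.
rewrite !mulrDr !mulrDl !mulrDr; lra.
Qed.

(** Slicing the range of [arrival tau x j] into intervals of length [e] reduces
    this to the independence of [tau x j], up to a factor [expR e]. *)
Lemma memoryless a a' B B' : 0 <= a -> 0 <= a' ->
  expR a * pr (holds base `&` late a B) * pr (Y x j @^-1` B') =
  expR a' * pr (holds base `&` late a' B') * pr (Y x j @^-1` B).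
Proof.
have le1 b b' D D' : 0 <= b -> 0 <= b' ->
    expR b * pr (holds base `&` late b D) * pr (Y x j @^-1` D') <=
    expR b' * pr (holds base `&` late b' D') * pr (Y x j @^-1` D).
  move=> b0 b'0; apply: le_expR_lim; first by rewrite !mulr_ge0 ?expR_ge0 ?pr_ge0.
  move=> e e0.
  (* [started] confines the arrival time to the range from 0 to [s], which finitely many slices of
     length [e] cover. *)
  have -> : holds base = holds (slice 0 ((Num.truncn (s / e)).+1%:R * e)).
    apply/seteqP; split => om; last by case.
    move=> [H1 H2]; split => //; move: H2; rewrite /started.
    have se : s < (Num.truncn (s / e)).+1%:R * e.
      by rewrite -ltr_pdivrMr //; have /andP[] := truncn_itv (divr_ge0 s0 (ltW e0)).
    case=> [/eqP j0|/andP[-> H]]; last by split => //; exact: lt_trans se.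
    by rewrite j0 /arrival big_ord0 lexx; split => //; exact: le_lt_trans se.
  exact: cmp_slices.
by move=> a0 a'0; apply/eqP; rewrite eq_le !le1.
Qed.

End memoryless.
End harris_markov.

(** * One-step inequality for a pair of dual walks *)

Section harris_step.
Context d (T : measurableType d) (R : realType) (P : probability T R).
Variables (p : int -> R) (tau : int -> nat -> T -> R) (Y : int -> nat -> T -> int).
Hypothesis data : harris_data P p tau Y.

Local Notation pr := (prob P).
Local Notation holds := (field_event tau Y).
Local Notation tau_at om := (fun z k => tau z k om).

Let hm (Phi : @field_pred R) : mpred Phi -> measurable (holds Phi).
Proof. by move=> mPhi; exact: (holds_meas data). Qed.
Local Notation pos_pred := (fun (tau : int -> nat -> R) (_ : int -> nat -> int) => positive tau).

Let pr_pos : pr (holds pos_pred) = 1 := pr_positive data.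
Let m_pos : mpred pos_pred := @mpred_positive R.

Section one_site.
Variables (x : int) (s : R) (Phi : @field_pred R).
Hypothesis s0 : 0 <= s.
Hypothesis mPhi : mpred Phi.
Hypothesis lPhi : local_pred x s Phi.

Local Notation base j := (erased x j s (fun tau Y => Phi tau Y /\ started x s j tau Y)).
Local Notation counted j := (fun tau Y => Phi tau Y /\ count_before tau x s j).

Let m_base j : mpred (base j).
Proof. by apply: mpred_erased; apply: mpred_and => //; exact: mpred_started. Qed.

Let m_counted j : mpred (counted j).
Proof. by apply: mpred_and => //; exact: mpred_count_before. Qed.

(** Locality replaces [Phi] by its erased version once [j] is the next arrival, which isolates the
    dependence on [tau x j]. *)
Let base_counted j tau' Y' : positive tau' ->
  counted j tau' Y' <-> base j tau' Y' /\ s <= evt tau' x j.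
Proof.
move=> pos; rewrite /erased /started arrival_erase //; split.
  by move=> [H cj]; have [st ev] := cj; split => //; split => //; apply/(lPhi _ pos cj).
by move=> [[H st] ev]; have cj : count_before tau' x s j by []; split => //; apply/(lPhi _ pos cj).
Qed.

Let pr_base_late j a B : 0 <= a ->
  pr (holds (base j) `&` late tau Y x j s a B) =
  expR (- a) * pr (holds (counted j)) * pr (Y x j @^-1` B).
Proof.
move=> a0; have := memoryless data x j s0 mPhi B setT a0 (lexx 0).
rewrite preimage_setT prT mulr1 expR0 mul1r => H.
have -> : pr (holds (counted j)) = pr (holds (base j) `&` late tau Y x j s 0 setT).
  apply: (pr_ae (C := holds pos_pred)) => //; try exact: hm.
    by apply: measurableI; [exact: hm | exact: (late_meas data)].
  move=> om /(base_counted j (fun z k => Y z k om)) H1; rewrite /late preimage_setT setIT addr0.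
  by split => [/H1[]|[? ?]] //; apply/H1.
by rewrite -mulrA -H mulrA -expRD addNr expR0 mul1r.
Qed.

(** Summation over the index [j] of the first arrival from [s] on: by non-explosion the events
    [counted j] almost surely partition [Phi], and the [D j] inherit their disjointness. *)
Let local_lower (E : @field_pred R) (D : nat -> @field_pred R) (c : R) :
  0 <= c -> mpred E -> (forall j, mpred (D j)) ->
  (forall j, c * pr (holds (counted j)) <= pr (holds (D j))) ->
  (forall j tau' Y', positive tau' -> D j tau' Y' ->
     counted j tau' Y' /\ E tau' Y') ->
  c * pr (holds Phi) <= pr (holds (fun tau Y => Phi tau Y /\ E tau Y)).
Proof.
move=> c0 mE mD cD DE.
pose A j := holds (counted j) `&` holds pos_pred.
pose B j := holds (D j) `&` holds pos_pred.
have mA j : measurable (A j) by apply: measurableI; exact: hm.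
have mB j : measurable (B j) by apply: measurableI; exact: hm.
have addpos Q : mpred Q -> pr (holds Q `&` holds pos_pred) = pr (holds Q).
  move=> mQ; apply: (pr_ae (C := holds pos_pred)) => //; try exact: hm.
    by apply: measurableI; exact: hm.
  by move=> om po; split => [[]|].
have trivA : trivIset setT A.
  move=> i j _ _ [om [[[_ ci] pos] [[_ cj] _]]].
  exact: count_before_inj pos ci cj.
have trivB : trivIset setT B.
  move=> i j _ _ [om [[Di pos] [Dj _]]].
  have [[_ ci] _] := DE i _ _ pos Di; have [[_ cj] _] := DE j _ _ pos Dj.
  exact: count_before_inj pos ci cj.
have mE' : mpred (fun tau Y => Phi tau Y /\ E tau Y) by exact: mpred_and.
rewrite -lee_fin pr_fin; last exact: hm.
apply: (@le_trans _ _ (P (\bigcup_j B j))); last first.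
  apply: le_measure; rewrite ?inE; [exact: bigcupT_measurable|exact: hm|].
  by move=> om [j _ [Dj pos]]; have [[? _] ?] := DE j _ _ pos Dj.
have -> : pr (holds Phi) = pr (\bigcup_j A j).
  pose G := holds (fun tau _ => exists j, s <= evt tau x j).
  have mexp : mpred (fun (tau : int -> nat -> R) (_ : int -> nat -> int) =>
      exists j, s <= evt tau x j).
    by apply: mpred_exists => j; apply: mpred_le; [exact: mreal_cst|exact: mreal_evt].
  rewrite -(addpos _ mPhi); apply: (pr_ae (C := G)).
  - by apply: measurableI; exact: hm.
  - exact: bigcupT_measurable.
  - exact: hm.
  - exact: (pr_no_explosion data).
  move=> om ex; split => [[ph pos]|[j _ [[ph _] pos]]] //.
  by have [j cj] := count_before_exists pos ex; exists j.
rewrite EFinM pr_fin; last exact: bigcupT_measurable.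
rewrite !measure_bigcup // -nneseriesZl; last by move=> *; exact: measure_ge0.
apply: lee_nneseries => [i _ _|j _]; first by rewrite mule_ge0.
have H : (c%:E * (pr (A j))%:E <= (pr (B j))%:E)%E.
  by rewrite -EFinM lee_fin /A /B !addpos //; exact: cD.
by rewrite (pr_fin P (mA j)) (pr_fin P (mB j)) in H; exact: H.
Qed.

Lemma quiet_lower h : 0 <= h ->
  expR (- h) * pr (holds Phi) <= pr (holds (fun tau Y => Phi tau Y /\ quiet x s h tau Y)).
Proof.
move=> h0; apply: (local_lower (D := fun j tau Y => base j tau Y /\ s + h <= evt tau x j)).
- exact: expR_ge0.
- exact: mpred_quiet.
- move=> j; apply: mpred_and => //.
  by apply: mpred_le; [exact: mreal_cst|exact: mreal_evt].
- move=> j; have := pr_base_late j setT h0.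
  rewrite preimage_setT prT mulr1 => <-; rewrite le_eqVlt; apply/orP; left; apply/eqP.
  by congr pr; rewrite /late preimage_setT setIT.
move=> j tau' Y' pos [H1 H2].
have cj : counted j tau' Y'.
  by apply/base_counted => //; split => //; apply: le_trans H2; rewrite lerDl.
by split => //; apply: count_before_quiet H2 => //; case: cj.
Qed.

(** [1 - expR (- h)] is for an arrival within the step, [p k] for its label and [expR (- h)] for the
    next waiting time being at least [h]. *)
Lemma rings_lower k h : 0 <= h ->
  expR (- h) * (1 - expR (- h)) * p k * pr (holds Phi) <=
  pr (holds (fun tau Y => Phi tau Y /\ rings x k s h tau Y)).
Proof.
move=> h0.
have p0 : 0 <= p k by rewrite -(pr_Y data 0 0%N) pr_ge0.
have e1 : 0 <= 1 - expR (- h) by rewrite subr_ge0 -expR0 ler_expR oppr_le0.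
pose Q j : @field_pred R := fun tau Y => base j tau Y /\
  ((s <= evt tau x j /\ evt tau x j < s + h) /\ Y x j = k).
have mQ j : mpred (Q j).
  apply: mpred_and => //; apply: mpred_and; last exact: mpred_Y.
  by apply: mpred_and; [apply: mpred_le|apply: mpred_lt];
    do ?[exact: mreal_evt | exact: mreal_cst].
apply: (local_lower (D := fun j tau Y => Q j tau Y /\ h <= tau x j.+1)).
- by rewrite !mulr_ge0 ?expR_ge0.
- exact: mpred_rings.
- by move=> j; apply: mpred_and => //; apply: mpred_le; [exact: mreal_cst|exact: mreal_tau].
- move=> j.
  have -> : holds (fun tau Y => Q j tau Y /\ h <= tau x j.+1) =
      holds (erased x j.+1 s (Q j)) `&` (tau x j.+1 @^-1` `[h, +oo[%classic `&` Y x j.+1 @^-1` setT).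
    rewrite preimage_setT setIT -tau_geE; congr (_ `&` _).
    apply/seteqP; split => om; rewrite /field_event /= /erased /Q /erased;
      rewrite erase_tauK erase_YK -[evt (erase_tau _ _ _ _) _ _]/(arrival _ x j.+1);
      rewrite arrival_erase // /erase_Y ltnn andbF //.
  rewrite (erased_indep data x s setT (mQ j) (leqnn j.+1) (measurable_itv _)).
  rewrite preimage_setT prT mulr1.
  rewrite -tau_geE.
  have -> : pr (holds (erased x j.+1 s (Q j))) = pr (holds (Q j)).
    congr pr; apply/seteqP; split => om; rewrite /field_event /= /erased /Q /erased;
      rewrite erase_tauK erase_YK -[evt (erase_tau _ _ _ _) _ _]/(arrival _ x j.+1);
      rewrite arrival_erase // /erase_Y ltnn andbF //.
  (* [Q j] is the difference of the late events with delays 0 and [h], both given by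
     [pr_base_late]. *)
  have -> : pr (holds (Q j)) = (1 - expR (- h)) * p k * pr (holds (counted j)).
    have := pr_base_late j [set k] (lexx 0); have := pr_base_late j [set k] h0.
    rewrite (pr_Y data) oppr0 expR0 mul1r => H1 H2.
    have mL a : measurable (late tau Y x j s a [set k]) by exact: (late_meas data).
    have := @pr_split _ _ _ P (holds (base j) `&` late tau Y x j s 0 [set k])
       (late tau Y x j s h [set k]).
    move=> /(_ (measurableI _ _ (hm (m_base j)) (mL 0)) (mL h)).
    have -> : holds (base j) `&` late tau Y x j s 0 [set k] `&` late tau Y x j s h [set k]
      = holds (base j) `&` late tau Y x j s h [set k].
      apply/seteqP; split => om [H3 [H4 H5]]; first by case: H3.
      split => //; split => //; split => //=; rewrite addr0.
      by apply: le_trans H4; rewrite lerDl.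
    have -> : holds (base j) `&` late tau Y x j s 0 [set k] `&` ~` late tau Y x j s h [set k]
      = holds (Q j).
      apply/seteqP; split => om.
        move=> [[H3 [/= H4 H5]] H6]; split => //; split => //; rewrite addr0 in H4.
        by split => //; rewrite ltNge; apply/negP => H7; apply: H6.
      move=> [H3 [[H4 H5] H6]]; split; first by split => //; split => //=; rewrite addr0.
      by move=> [/= H7 _]; move: H5; rewrite ltNge H7.
    by rewrite H1 H2; lra.
  have := pr_tau_ge_lower data x j.+1 h0.
  set u := pr [set _ | _]; set v := pr _ => uh.
  have -> : expR (- h) * (1 - expR (- h)) * p k * v = (1 - expR (- h)) * p k * v * expR (- h) by ring.
  by rewrite ler_wpM2l // !mulr_ge0 ?pr_ge0.
move=> j tau' Y' pos [[H1 [[H2 H3] H4]] H5].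
have cj : counted j tau' Y' by apply/base_counted.
by split => //; exists j; split => //; case: cj.
Qed.

End one_site.

Definition pair_pred (H1 H2 : pred int) s x y : @field_pred R :=
  fun tau Y => ends_in H1 s x tau Y /\ ends_in H2 s y tau Y.

Let m_pair H1 H2 s x y : mpred (pair_pred H1 H2 s x y).
Proof. by apply: mpred_and; exact: mpred_ends_in. Qed.

Let l_pair z H1 H2 s x y : 0 <= s -> local_pred z s (pair_pred H1 H2 s x y).
Proof. by move=> s0; apply: local_and; exact: local_ends_in. Qed.

(** Only the first walk moves during the step, from [x] to [x + k]. For [k = 0] the landing site is
    [x], which rings and cannot be required to be quiet. *)
Definition ring_pred H1 H2 s h k x y : @field_pred R := fun tau Y =>
  ((pair_pred H1 H2 s (x + k) y tau Y /\ rings x k s h tau Y) /\ quiet y s h tau Y)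
  /\ (k != 0 -> quiet (x + k) s h tau Y).

Let m_ring H1 H2 s h k x y : mpred (ring_pred H1 H2 s h k x y).
Proof.
apply: mpred_and; last by apply: mpred_imply; [exact: mpred_cst | exact: mpred_quiet].
apply: mpred_and; last exact: mpred_quiet.
by apply: mpred_and => //; exact: mpred_rings.
Qed.

(** The requirements at [x], [y] and [x + k] are added one site at a time, what precedes being local
    at the next site. If [k = 0] or [x + k = y] the third one is void or already met, and its factor
    [expR (- h) <= 1] is given away. *)
Lemma ring_pred_lower H1 H2 s h k x y : x != y -> 0 <= s -> 0 <= h ->
  expR (- h) ^+ 3 * (1 - expR (- h)) * p k * pr (holds (pair_pred H1 H2 s (x + k) y)) <=
  pr (holds (ring_pred H1 H2 s h k x y)).
Proof.
move=> xy s0 h0.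
have e0 : 0 <= expR (- h) by exact: expR_ge0.
have e1 : expR (- h) <= 1 by rewrite -expR0 ler_expR oppr_le0.
have r1 := rings_lower s0 (@m_pair H1 H2 s (x + k) y) (@l_pair x H1 H2 s (x + k) y s0) k h0.
pose Phi1 : @field_pred R := fun tau Y => pair_pred H1 H2 s (x + k) y tau Y /\ rings x k s h tau Y.
have m1 : mpred Phi1 by apply: mpred_and => //; exact: mpred_rings.
have l1 z : x != z -> local_pred z s Phi1.
  by move=> xz; apply: local_and; [exact: l_pair | exact: local_rings].
have r2 := quiet_lower s0 m1 (l1 y xy) h0.
pose Phi2 : @field_pred R := fun tau Y => Phi1 tau Y /\ quiet y s h tau Y.
have m2 : mpred Phi2 by apply: mpred_and => //; exact: mpred_quiet.
have r12 := le_trans (ler_wpM2l e0 r1) r2.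
have [/orP kxy|/norP[k0 xky]] := boolP ((k == 0) || (x + k == y)).
  have -> : holds (ring_pred H1 H2 s h k x y) = holds Phi2.
    apply/seteqP; split => om; first by case.
    move=> H; split => // k0; case: kxy => [/eqP kk|/eqP ->]; last by case: H.
    by move: k0; rewrite kk eqxx.
  apply: le_trans r12; rewrite !exprS expr0 mulr1 !mulrA.
  have p0 : 0 <= p k by rewrite -(pr_Y data 0 0%N) pr_ge0.
  do 3 rewrite ler_wpM2r ?pr_ge0 ?subr_ge0 //.
  by rewrite -[leRHS]mulr1 ler_wpM2l // mulr_ge0.
have l2 : local_pred (x + k) s Phi2.
  apply: local_and; last by apply: local_quiet; rewrite eq_sym.
  by apply: l1; rewrite eq_sym -subr_eq0 addrC addKr.
have := le_trans (ler_wpM2l e0 r12) (quiet_lower s0 m2 l2 h0).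
rewrite !exprS expr0 mulr1 !mulrA => /le_trans; apply.
have m3 : mpred (fun tau Y => Phi2 tau Y /\ quiet (x + k) s h tau Y).
  by apply: mpred_and => //; exact: mpred_quiet.
by apply: pr_le; [exact: hm | exact: hm | move=> om [H3 H4]; split].
Qed.

Lemma ring_pred_pair H1 H2 s h k x y tau' Y' : 0 <= h -> positive tau' ->
  ring_pred H1 H2 s h k x y tau' Y' -> pair_pred H1 H2 (s + h) x y tau' Y'.
Proof.
move=> h0 pos [[[[e1 e2] rg] q1] q2]; split.
  exact: ends_in_rings rg e1 q2.
exact: ends_in_quiet e2 q1.
Qed.

(** Different labels [k] give disjoint events. Recording which site is quiet keeps the moves of the
    two walks disjoint in [pair_one_step]. *)
Lemma sum_ring_pred_le H1 H2 s h x y N : 0 <= h ->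
  \sum_(k <- zrange N) pr (holds (ring_pred H1 H2 s h k x y)) <=
  pr (holds (fun tau Y => pair_pred H1 H2 (s + h) x y tau Y /\
    (~ quiet x s h tau Y /\ quiet y s h tau Y))).
Proof.
move=> h0.
rewrite (eq_bigr (fun k => pr (holds (ring_pred H1 H2 s h k x y) `&` holds pos_pred))); last first.
  move=> k _; apply: (pr_ae (C := holds pos_pred)) => //; try exact: hm.
    by apply: measurableI; exact: hm.
  by move=> om po; split => [|[]].
apply: sum_pr_le; first exact: zrange_uniq.
- apply: hm; apply: mpred_and => //; apply: mpred_and; last exact: mpred_quiet.
  by apply: mpred_not; exact: mpred_quiet.
- by move=> k; apply: measurableI; exact: hm.
- move=> k _ om [rp pos]; split; first exact: ring_pred_pair rp.
  split; last by case: rp => -[[]].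
  by move=> q; case: rp => -[[_ rg] _] _; exact: quiet_not_rings q rg.
move=> k k' [om [[[[[_ rk] _] _] pos] [[[[_ rk'] _] _] _]]].
exact: rings_inj pos rk rk'.
Qed.

(** The event is split according to whether neither site rings ([B0]), [x] rings and [y] does not
    ([Bx]), or the converse ([By]). The error is [4 * h ^+ 2] times [Zx + Zy <= 2]. *)
Lemma pair_one_step H1 H2 s h x y N : x != y -> 0 <= s -> 0 < h ->
  \sum_(k <- zrange N) p k <= 1 ->
  (1 - 2 * h) * pr (holds (pair_pred H1 H2 s x y)) +
  h * \sum_(k <- zrange N) p k * (pr (holds (pair_pred H1 H2 s (x + k) y)) +
     pr (holds (pair_pred H1 H2 s x (y + k)))) - 8 * h ^+ 2
  <= pr (holds (pair_pred H1 H2 (s + h) x y)).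
Proof.
move=> xy s0 h_gt0 p1; have h0 := ltW h_gt0.
have p0 k : 0 <= p k by rewrite -(pr_Y data 0 0%N) pr_ge0.
set b := pr (holds (pair_pred H1 H2 s x y)).
have e0 : 0 <= expR (- h) by exact: expR_ge0.
have eh : 1 - h <= expR (- h) by exact: expR_ge1Dx.
have mq z : measurable (holds (quiet z s h)) by apply: hm; exact: mpred_quiet.
have mp' := hm (@m_pair H1 H2 (s + h) x y).
have mqx : mpred (fun tau Y => pair_pred H1 H2 s x y tau Y /\ quiet x s h tau Y).
  by apply: mpred_and => //; exact: mpred_quiet.
have B0 : expR (- h) * (expR (- h) * b) <=
    pr (holds (pair_pred H1 H2 (s + h) x y) `&` holds (quiet x s h) `&` holds (quiet y s h)).
  have q1 := quiet_lower s0 (@m_pair H1 H2 s x y) (@l_pair x H1 H2 s x y s0) h0.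
  have q2 : _ <= _ := quiet_lower s0 mqx _ h0 (x := y).
  apply: le_trans (ler_wpM2l e0 q1) (le_trans (q2 _) _).
    by apply: local_and; [exact: l_pair | exact: local_quiet].
  apply: pr_le.
  - by apply: hm; apply: mpred_and => //; exact: mpred_quiet.
  - by do 2 apply: measurableI => //.
  move=> om [[[H3 H4] H5] H6]; split; [split|] => //.
  by split; [exact: ends_in_quiet H5 | exact: ends_in_quiet H6].
pose c := expR (- h) ^+ 3 * (1 - expR (- h)).
pose Zx := \sum_(k <- zrange N) p k * pr (holds (pair_pred H1 H2 s (x + k) y)).
pose Zy := \sum_(k <- zrange N) p k * pr (holds (pair_pred H1 H2 s x (y + k))).
have Bx : c * Zx <=
    pr (holds (pair_pred H1 H2 (s + h) x y) `&` ~` holds (quiet x s h)).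
  apply: (@le_trans _ _ (\sum_(k <- zrange N) pr (holds (ring_pred H1 H2 s h k x y)))).
    rewrite mulr_sumr; apply: ler_sum => k _; rewrite mulrA; exact: ring_pred_lower.
  apply: le_trans; first exact: sum_ring_pred_le.
  apply: pr_le.
  - apply: hm; apply: mpred_and => //; apply: mpred_and; last exact: mpred_quiet.
    by apply: mpred_not; exact: mpred_quiet.
  - by apply: measurableI => //; exact: measurableC.
  by move=> om [H3 [H4 H5]].
have pC s' x' y' : holds (pair_pred H1 H2 s' x' y') = holds (pair_pred H2 H1 s' y' x').
  by apply/seteqP; split => om [].
have By : c * Zy <=
    pr (holds (pair_pred H1 H2 (s + h) x y) `&` holds (quiet x s h) `&` ~` holds (quiet y s h)).
  apply: (@le_trans _ _ (\sum_(k <- zrange N) pr (holds (ring_pred H2 H1 s h k y x)))).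
    rewrite mulr_sumr; apply: ler_sum => k _; rewrite mulrA pC; apply: ring_pred_lower => //.
    by rewrite eq_sym.
  apply: le_trans; first exact: sum_ring_pred_le.
  apply: pr_le.
  - apply: hm; apply: mpred_and => //; apply: mpred_and; last exact: mpred_quiet.
    by apply: mpred_not; exact: mpred_quiet.
  - by apply: measurableI; [exact: measurableI | exact: measurableC].
  by move=> om [[H3 H3'] [H4 H5]].
have sp1 := pr_split P mp' (mq x).
have sp2 := pr_split P (measurableI _ _ mp' (mq x)) (mq y).
have -> : \sum_(k <- zrange N) p k * (pr (holds (pair_pred H1 H2 s (x + k) y)) +
     pr (holds (pair_pred H1 H2 s x (y + k)))) = Zx + Zy.
  by rewrite /Zx /Zy -big_split /=; apply: eq_bigr => k _; rewrite mulrDr.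
have Z1 (F : int -> R) : (forall k, 0 <= F k <= 1) ->
    0 <= \sum_(k <- zrange N) p k * F k <= 1.
  move=> F01; apply/andP; split.
    by apply: sumr_ge0 => k _; rewrite mulr_ge0 //; case/andP: (F01 k).
  apply: le_trans p1; apply: ler_sum => k _.
  by rewrite -[leRHS]mulr1 ler_wpM2l //; case/andP: (F01 k).
have b01 s' x' y' : 0 <= pr (holds (pair_pred H1 H2 s' x' y')) <= 1.
  by rewrite pr_ge0 pr_le1 //; exact: hm.
have /andP[Zx0 Zx1] := Z1 _ (fun k => b01 s (x + k) y).
have /andP[Zy0 Zy1] := Z1 _ (fun k => b01 s x (y + k)).
rewrite -/Zx -/Zy in Zx0 Zx1 Zy0 Zy1.
have /andP[b0 b1] := b01 s x y; rewrite -/b in b0 b1.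
(* [c] is rewritten with one more factor [expR (- h)], turning [1 - expR (- h)] into
   [expR h - 1 >= h]. *)
have ch : h * (1 - 4 * h) <= c.
  have -> : c = expR (- h) ^+ 4 * (expR h - 1).
    have uv : 1 = expR (- h) * expR h by rewrite -expRD addNr expR0.
    by rewrite /c {1}uv; ring.
  have e4 : 1 - 4 * h <= expR (- h) ^+ 4.
    rewrite -expRM_natl; apply: le_trans (expR_ge1Dx _); lra.
  have eh1 : h <= expR h - 1 by have := expR_ge1Dx h; lra.
  have e40 : 0 <= expR (- h) ^+ 4 by rewrite exprn_ge0.
  rewrite mulrC; apply: le_trans (ler_wpM2l e40 eh1).
  by rewrite ler_wpM2r.
have cZ : h * (Zx + Zy) - 8 * h ^+ 2 <= c * Zx + c * Zy.
  have := ler_wpM2r (addr_ge0 Zx0 Zy0) ch.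
  have : 4 * h ^+ 2 * (Zx + Zy) <= 4 * h ^+ 2 * 2.
    by rewrite ler_wpM2l ?mulr_ge0 ?sqr_ge0 //; lra.
  by rewrite !expr2; lra.
have e2b : (1 - 2 * h) * b <= expR (- h) * (expR (- h) * b).
  rewrite mulrA ler_wpM2r // -expRD; apply: le_trans (expR_ge1Dx _); lra.
lra.
Qed.

End harris_step.

(** * The interface *)

Section interface.
Context {R : realType}.
Implicit Types (tau : int -> nat -> R) (Y : int -> nat -> int).

Definition is_pos (z : int) : bool := 0 < z.

Lemma voter_oneE tau Y t x : voter_one tau Y t x <-> ends_in heaviside t x tau Y.
Proof.
split=> [[y [/bwd_endsP[l pl] hy]]|[l [y [pl hy]]]]; first by exists l, y.
by exists y; split => //; apply/bwd_endsP; exists l.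
Qed.

Lemma ends_pos_not_voter_one tau Y t y :
  ends_in is_pos t y tau Y -> ~ voter_one tau Y t y.
Proof.
move=> [l [z [pl zpos]]] /voter_oneE[l' [z' [pl' z'neg]]].
by move: z'neg; rewrite -(dual_path_inj pl pl') /heaviside leNgt -/(is_pos z) zpos.
Qed.

Lemma wide_interface tau Y t x y (M : R) : M < (x - y)%:~R ->
  pair_pred heaviside is_pos t x y tau Y ->
  (M%:E < `| r_t tau Y t - l_t tau Y t |)%E.
Proof.
move=> Mxy [/voter_oneE vx /ends_pos_not_voter_one vy].
have rx : ((x%:~R : R)%:E <= r_t tau Y t)%E by apply: ereal_sup_ubound; exists x.
have ly : (l_t tau Y t <= (y%:~R : R)%:E)%E by apply: ereal_inf_lbound; exists y.
apply: (@lt_le_trans _ _ (x%:~R - y%:~R)%:E); first by rewrite lte_fin -intrB.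
by apply: le_trans (lee_abs _); rewrite EFinB; exact: leeB.
Qed.

(** [r_t] exceeds [a] exactly when some site above [a] carries a one, a countable union; [l_t] is
    treated dually. *)
Lemma wide_interface_meas d (T : measurableType d)
    (tau : int -> nat -> T -> R) (Y : int -> nat -> T -> int) t (M : R) :
  measurable_fields tau Y ->
  measurable [set om | (M%:E < `| r_t (fun z k => tau z k om) (fun z k => Y z k om) t
                             - l_t (fun z k => tau z k om) (fun z k => Y z k om) t |)%E ].
Proof.
move=> mf.
pose r om := r_t (fun z k => tau z k om) (fun z k => Y z k om) t.
pose l om := l_t (fun z k => tau z k om) (fun z k => Y z k om) t.
have mv x : measurable [set om | voter_one (fun z k => tau z k om) (fun z k => Y z k om) t x].
  rewrite (_ : [set _ | _] = field_event tau Y (ends_in heaviside t x)).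
    exact: (mpred_ends_in _ _ _ mf).
  by apply/seteqP; split => om /=; move/voter_oneE.
have mr : measurable_fun setT r.
  apply: (measurability _ (ErealGenOInfty.measurableE R)) => //.
  move=> _ [_ [a ->] <-]; rewrite setTI.
  rewrite (_ : _ @^-1` _ = \bigcup_(x : int) (if a < x%:~R then
     [set om | voter_one (fun z k => tau z k om) (fun z k => Y z k om) t x] else set0)).
    by apply: countable_bigcupT_measurable => // x; case: ifP.
  apply/seteqP; split => [om|om [x _]] /=; rewrite in_itv /= andbT.
    by move=> /ereal_sup_gt[_ [x vx <-]]; rewrite lte_fin => ax; exists x; rewrite ?ax.
  case: ifP => // ax vx; apply: (@lt_le_trans _ _ (x%:~R)%:E); first by rewrite lte_fin.
  by apply: ereal_sup_ubound; exists x.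
have ml : measurable_fun setT l.
  apply: (measurability _ (ErealGenInftyO.measurableE R)) => //.
  move=> _ [_ [a ->] <-]; rewrite setTI.
  rewrite (_ : _ @^-1` _ = \bigcup_(x : int) (if x%:~R < a then
     ~` [set om | voter_one (fun z k => tau z k om) (fun z k => Y z k om) t x] else set0)).
    by apply: countable_bigcupT_measurable => // x; case: ifP => // _; exact: measurableC.
  apply/seteqP; split => [om|om [x _]] /=; rewrite in_itv /=.
    by move=> /ereal_inf_lt[_ [x vx <-]]; rewrite lte_fin => ax; exists x; rewrite ?ax.
  case: ifP => // ax vx; apply: (@le_lt_trans _ _ (x%:~R)%:E); last by rewrite lte_fin.
  by apply: ereal_inf_lbound; exists x.
have := emeasurable_fun_o_infty measurableT (_ : measurable_fun setT (fun om => `|r om - l om|%E)) M%:E.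
rewrite setTI; apply; apply: measurableT_comp => //; exact: emeasurable_funB.
Qed.

End interface.

(** * Crossing probability at a heavy scale, and conclusion *)

Section crossing.
Context d (T : measurableType d) (R : realType) (P : probability T R).
Variables (p : int -> R) (tau : int -> nat -> T -> R) (Y : int -> nat -> T -> int).
Hypothesis data : harris_data P p tau Y.
Hypothesis p0 : forall k, 0 <= p k.
Hypothesis p1 : forall N, \sum_(k <- zrange N) p k <= 1.

Definition crossing s x y : R := prob P (field_event tau Y (pair_pred heaviside is_pos s x y)).

Lemma crossing_init x y : x < 0 < y -> 1 <= crossing 0 x y.
Proof.
move=> /andP[x0 y0]; rewrite /crossing.
rewrite (_ : field_event _ _ _ = setT) ?prT //; apply/seteqP; split => // om _.
have nil_path z : dual_path (fun z k => tau z k om) (fun z k => Y z k om) z 0 [::] z.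
  by split => // j /andP[j0 /(lt_trans j0)]; rewrite ltxx.
by split; [exists [::], x; rewrite /heaviside ltW | exists [::], y].
Qed.

(** One of the two tails carries at least [F / 2]; a heavy left tail is the case of
    [pair_lower_bound], a heavy right tail is reduced to it by reflection. *)
Lemma crossing_lower eps L N n (F : R) (theta := trunc_theta p (zrange N) L)
    (t := (8 * theta)^-1) :
  1 <= L -> 0 < theta -> 1 - \sum_(k <- zrange N) p k <= eps ->
  t / n.+1%:R <= 1 / 20%:R ->
  F <= \sum_(k <- zrange N | 8 * L <= `|k%:~R|) p k ->
  exists x y : int, 2 * L <= (x - y)%:~R /\
    F / 2 / (64%:R * theta) - t * (2 * eps + 8 * (t / n.+1%:R)) <= crossing t x y.
Proof.
move=> L1 th0 peps tn FQ.
have L0 : 0 < L by exact: lt_le_trans L1.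
set lft := \sum_(k <- zrange N | k%:~R <= - (8 * L)) p k.
set rgt := \sum_(k <- zrange N | 8 * L <= k%:~R) p k.
have lr : \sum_(k <- zrange N | 8 * L <= `|k%:~R|) p k <= lft + rgt.
  rewrite /lft /rgt big_mkcond [X in _ <= X + _]big_mkcond [X in _ <= _ + X]big_mkcond.
  rewrite -big_split /=; apply: ler_sum => k _.
  case: ifPn => [|_]; last by rewrite addr_ge0 //; case: ifP.
  rewrite ler_normr => /orP[->|]; first by rewrite lerDr; case: ifP.
  by rewrite lerNr => ->; rewrite lerDl; case: ifP.
have cr0 s x y : 0 <= crossing s x y by exact: pr_ge0.
have finish S : F / 2 <= S -> F / 2 / (64%:R * theta) <= S / (64%:R * theta).
  by move=> FS; rewrite ler_wpM2r // invr_ge0 mulr_ge0 ?ler0n ?(ltW th0).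
have step s h x y : x != y -> 0 <= s -> 0 < h -> (1 - 2 * h) * crossing s x y
  + h * \sum_(k <- zrange N) p k * (crossing s (x + k) y + crossing s x (y + k)) - 8 * h ^+ 2
  <= crossing (s + h) x y.
  by move=> xy s0 h0; exact: (pair_one_step data _ _ xy s0 h0 (p1 N)).
have [Fl|Fl] := lerP (F / 2) lft.
  have [x [y [xy H]]] := pair_lower_bound p0 (p1 N) peps cr0 crossing_init step L1 th0 tn.
  by exists x, y; split => //; apply: le_trans H; rewrite lerD2r finish.
have Fr : F / 2 <= rgt by lra.
(* Reflection in 0 exchanges the tails and the roles of the two walks, hence the sites [- y] and
   [- x] in [b] below. *)
pose q k := p (- k).
have q0 k : 0 <= q k by exact: p0.
have q1 : \sum_(k <- zrange N) q k <= 1 by rewrite (sum_zrangeN N p predT).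
have qeps : 1 - \sum_(k <- zrange N) q k <= eps by rewrite (sum_zrangeN N p predT).
have thE : trunc_theta q (zrange N) L = theta.
  rewrite /theta /trunc_theta -[RHS](sum_zrangeN N _ predT); apply: eq_bigr => k _.
  by rewrite /q intrN sqrrN.
pose b s x y := crossing s (- y) (- x).
have binit x y : x < 0 < y -> 1 <= b 0 x y.
  by move=> /andP[x0 y0]; apply: crossing_init; rewrite oppr_lt0 oppr_gt0 y0.
have bstep s h x y : x != y -> 0 <= s -> 0 < h -> (1 - 2 * h) * b s x y
  + h * \sum_(k <- zrange N) q k * (b s (x + k) y + b s x (y + k)) - 8 * h ^+ 2
  <= b (s + h) x y.
  move=> xy s0 h0; apply: le_trans (step s h (- y) (- x) _ s0 h0); last first.
    by rewrite eqr_opp eq_sym.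
  rewrite -(sum_zrangeN N (fun k => p k * _) predT) /= le_eqVlt; apply/orP; left; apply/eqP.
  congr (_ + _ * _ - _); apply: eq_bigr => k _.
  by rewrite /b /q !opprD addrC.
have th0' : 0 < trunc_theta q (zrange N) L by rewrite thE.
have tn' : (8 * trunc_theta q (zrange N) L)^-1 / n.+1%:R <= 1 / 20%:R by rewrite thE.
have [x [y [xy H]]] := pair_lower_bound q0 q1 qeps (fun s x y => cr0 s (- y) (- x)) binit bstep L1 th0' tn'.
exists (- y), (- x); split; first by rewrite opprK addrC.
rewrite thE in H; apply: le_trans H; rewrite lerD2r finish //.
apply: le_trans Fr _; rewrite le_eqVlt; apply/orP; left; apply/eqP.
rewrite /rgt -(sum_zrangeN N p (fun k => 8 * L <= k%:~R)).
by apply: eq_bigl => k; rewrite intrN lerNr.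
Qed.

End crossing.

Theorem theorem2 (d : measure_display) (T : measurableType d) (R : realType)
    (P : probability T R) (p : int -> R)
    (tau : int -> nat -> T -> R) (Y : int -> nat -> T -> int) :
  transition_kernel_Z p -> irreducible_kernel p -> finite_first_moment p ->
  (exists c : R, c < 2 /\ infinite_moment p c) ->
  harris_data P p tau Y ->
  (* (r_t - l_t)_{t >= 0} is not tight *)
  ~ (forall eps : R, 0 < eps -> exists M : R, forall t : R, 0 <= t ->
       (P [set om | (M%:E < `| r_t (fun z k => tau z k om) (fun z k => Y z k om) t
                             - l_t (fun z k => tau z k om) (fun z k => Y z k om) t |)%E ]
        <= eps%:E)%E).
Proof.
move=> [p0 p1] _ _ [c [c2 infc]] data tight.
have p1N N : \sum_(k <- zrange N) p k <= 1.
  by rewrite -lee_fin -p1; exact: esum_ge_zrange.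
have pc B : exists N, B < \sum_(k <- zrange N) (`|k|%:~R : R) `^ c * p k.
  have [||N HN] := @esum_gt_zrange R (fun k => (`|k|%:~R : R) `^ c * p k) B.
  - by move=> k; rewrite mulr_ge0 ?powR_ge0.
  - by move: infc; rewrite /infinite_moment => ->; exact: ltry.
  by exists N; exact: HN.
have [kappa k0 scales] := heavy_scale p0 p1N c2 pc.
(* The crossing probability will be at least [kappa / 128 - 2 * (kappa / 1024) - kappa / 512 = kappa
   / 256], which exceeds this level. *)
have [M HM] := tight (kappa / 512%:R) (divr_gt0 k0 (ltr0n _ 512)).
have [L [ML L1 freq]] := scales M.
have L0 : 0 < L by exact: lt_le_trans L1.
have [N1 _ HN1] := freq 0%N.
have th_mono N N' : (N <= N')%N -> trunc_theta p (zrange N) L <= trunc_theta p (zrange N') L.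
  move=> NN'; apply: ler_sum_zrange => // k.
  by rewrite mulr_ge0 // le_min ler01 /= divr_ge0 // sqr_ge0.
set th1 := trunc_theta p (zrange N1) L in HN1.
(* The tail lies strictly above [kappa * th1 >= 0] and is at most [th1]. *)
have th1_gt0 : 0 < th1.
  apply: (@le_lt_trans _ _ (kappa * th1)).
    by rewrite mulr_ge0 ?(ltW k0) // trunc_theta_ge0.
  apply: (lt_le_trans HN1); rewrite big_mkcond /=; apply: ler_sum => k _.
  case: ifPn => kL; last by rewrite mulr_ge0 // le_min ler01 /= divr_ge0 // sqr_ge0.
  rewrite -[leLHS]mulr1 ler_wpM2l // le_min lexx /= ler_pdivlMr ?exprn_gt0 // mul1r.
  rewrite -[leRHS]real_normK ?num_real // ler_pXn2r ?nnegrE ?(ltW L0) //.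
  by apply: le_trans kL; lra.
(* [eps] must be fixed before [N], on which [t] depends; since [th1 <= th], [t * th1 <= 1 / 8] and
   [t * eps <= kappa / 1024] for every later [N]. *)
pose eps := kappa * th1 / 128%:R.
have eps0 : 0 < eps by rewrite divr_gt0 ?ltr0n // mulr_gt0.
have [|N2 HN2] := @esum_gt_zrange R p (1 - eps) p0.
  by rewrite p1 lte_fin; lra.
have [N NN HN] := freq (maxn N1 N2).
move: NN; rewrite geq_max => /andP[NN1 NN2].
set th := trunc_theta p (zrange N) L in HN.
have th1th : th1 <= th by exact: th_mono.
have th0 : 0 < th by exact: lt_le_trans th1th.
pose t := (8 * th)^-1.
have t0 : 0 < t by rewrite invr_gt0 mulr_gt0.
(* Bound on the grid step: the first term is required by [crossing_lower], the second keeps the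
   discretisation error below [kappa / 512]. *)
pose e := Num.min (1 / 20%:R) (kappa / (8 * 512%:R * t)).
have e0 : 0 < e by rewrite lt_min !divr_gt0 ?mulr_gt0 ?ltr0n.
pose n := Num.truncn (t / e).
have tn : t / n.+1%:R <= e.
  rewrite ler_pdivrMr ?ltr0n // mulrC -ler_pdivrMr // ltW //.
  by have /andP[] := truncn_itv (divr_ge0 (ltW t0) (ltW e0)).
have tn1 : t / n.+1%:R <= 1 / 20%:R by apply: le_trans tn _; rewrite ge_min lexx.
have tn2 : t / n.+1%:R <= kappa / (8 * 512%:R * t).
  by apply: le_trans tn _; rewrite ge_min lexx orbT.
have peps : 1 - \sum_(k <- zrange N) p k <= eps by have := HN2 N NN2; lra.
have [x [y [xy H]]] := crossing_lower data p0 p1N L1 th0 peps tn1 (ltW HN).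
have Mxy : M < (x - y)%:~R by apply: lt_le_trans xy; lra.
have mW := wide_interface_meas t M (harris_fields data).
have mC : measurable (field_event tau Y (pair_pred heaviside is_pos t x y)).
  by apply: (holds_meas data); apply: mpred_and; exact: mpred_ends_in.
have low : crossing P tau Y t x y <= kappa / 512%:R.
  rewrite -lee_fin; apply: le_trans (HM t (ltW t0)).
  rewrite -(pr_fin P mW) lee_fin; apply: pr_le => //.
  by move=> om; exact: wide_interface.
have tth : t * th = 1 / 8.
  by rewrite /t invfM -mulrA mulVf ?gt_eqF // mulr1 div1r.
have b1 : kappa * th / 2 / (64%:R * th) = kappa / 128%:R.
  by field; rewrite gt_eqF.
have b2 : t * eps <= kappa / 1024%:R.
  have : t * th1 <= 1 / 8 by rewrite -tth ler_wpM2l // ltW.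
  move=> /(ler_wpM2l (ltW k0)) H1.
  have -> : t * eps = kappa * (t * th1) / 128%:R by rewrite /eps; ring.
  have -> : kappa / 1024%:R = kappa * (1 / 8) / 128%:R by field.
  by rewrite ler_wpM2r ?invr_ge0 ?ler0n.
have b3 : t * (8 * (t / n.+1%:R)) <= kappa / 512%:R.
  rewrite mulrCA -ler_pdivlMl //.
  apply: le_trans (ler_wpM2l (ltW t0) tn2) _.
  rewrite le_eqVlt; apply/orP; left; apply/eqP; field.
  by rewrite gt_eqF.
move: H; rewrite -/th -/t b1 (mulrDr t) (mulrCA t 2) => H.
have := le_trans (lerB (lexx _) (lerD (ler_wpM2l (ler0n _ 2) b2) b3)) (le_trans H low).
lra.
Qed.
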